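(* Let $\Gamma=(X,R)$ be a bipartite distance-regular graph with diameter $D\ge4$ and valency $k\ge3$, and fix $x\in X$. The following are equivalent: (i) $U_\eta=E^*_2H_\eta$ for all $\eta\in\mathbb{R}$; (ii) $\mathrm{mult}_\eta=\mu_\eta$ for all $\eta\in\mathbb{R}$; (iii) every irreducible $T(x)$-module with endpoint $2$ is thin.
   Context: $\Gamma$ is a finite connected bipartite distance-regular graph with distance $\partial$, intersection numbers $b_i,c_i$, $k_2$ the number of vertices at distance $2$ from $x$. $A_i$ distance matrices, $A=A_1$; $V=\mathbb{C}^X$ with $\langle u,w\rangle=u^t\bar w$. $E^*_i$ diagonal with $(y,y)$-entry $1$ if $\partial(x,y)=i$, else $0$; $T=T(x)$ generated by $A,E^*_0,\dots,E^*_D$; thin: $\dim E^*_iW\le1$ for all $i$; endpoint $\min\{i:E^*_iW\ne0\}$; local eigenvalue of thin irreducible $W$ with endpoint 2: eigenvalue of $E^*_2A_2E^*_2$ on $E^*_2W$. $U$ is the orthogonal complement in $E^*_2V$ of $E^*_2V_0+E^*_2Y$, where $V_0$ is the unique irreducible $T$-module with endpoint $0$ and $Y$ is the span of all irreducible $T$-modules with endpoint $1$; $U_\eta=\{u\in U:E^*_2A_2E^*_2u=\eta u\}$. $H_\eta$ is the span of all thin irreducible $T$-modules with endpoint $2$ and local eigenvalue $\eta$. $\mu_\eta$ is the multiplicity with which a thin irreducible $T$-module with endpoint $2$ and local eigenvalue $\eta$ appears in an orthogonal decomposition of $V$ into irreducible $T$-modules ($\mu_\eta=0$ if none exists). With the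 local eigenvalues $\eta_1,\dots,\eta_{k_2}$ (eigenvalues of the graph on vertices at distance $2$ from $x$, adjacency = distance $2$) ordered so $\eta_1=p^2_{22}$ and $\eta_i=b_3-1$ for $2\le i\le k$, $\mathrm{mult}_\eta$ is the number of times $\eta$ appears among $\eta_{k+1},\dots,\eta_{k_2}$; equivalently $\mathrm{mult}_\eta=\dim U_\eta$. *)

(* Defs.v *)
From HB Require Import structures.
From mathcomp Require Import all_boot all_order all_algebra.
From mathcomp Require Import boolp classical_sets reals complex.

Set Implicit Arguments.
Unset Strict Implicit.
Unset Printing Implicit Defensive.

Import Order.TTheory GRing.Theory Num.Theory.

Local Open Scope classical_set_scope.
Local Open Scope ring_scope.

(** * Distance-regular graphs *)

Section Graph.
Variables (X : finType) (e : rel X).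

Definition simple_graph := symmetric e /\ irreflexive e.

Definition graph_connected := forall y z, connect e y z.

Definition bipartite := exists c : X -> bool, forall y z, e y z -> c y != c z.

(* Least length of a walk from y to z (#|X| if there is none, which does not
   happen in a connected graph, where all distances are < #|X|). *)
Definition dist (y z : X) : nat :=
  find (fun n => [exists w : n.-tuple X, path e y w && (last y w == z)])
       (iota 0 #|X|).

Definition diameter : nat := \max_(y : X) \max_(z : X) dist y z.

(* p h i j is the intersection number p^h_{ij}; its value is only meaningful
   for h <= diameter. *)
Definition distance_regular (p : nat -> nat -> nat -> nat) :=
  graph_connected /\
  forall (y z : X) (i j : nat),
    #|[pred w | (dist y w == i) && (dist w z == j)]| = p (dist y z) i j.

End Graph.

Definition inter_b (p : nat -> nat -> nat -> nat) (i : nat) : nat := p i i.+1 1%N.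
Definition valency (p : nat -> nat -> nat -> nat) : nat := p 0%N 1%N 1%N.

(** * The Terwilliger algebra and its modules *)

(* Rows and columns are indexed by X through enum_val, so that
   C^X is 'cV[C]_#|X|. *)
Section Terwilliger.
Variables (C : numClosedFieldType) (X : finType) (e : rel X) (x : X).

Local Notation MX := 'M[C]_#|X|.
Local Notation V := 'cV[C]_#|X|.

Definition dist_mx (i : nat) : MX :=
  \matrix_(a, b) (dist e (enum_val a) (enum_val b) == i)%:R.

Definition Estar (i : nat) : MX :=
  \matrix_(a, b) ((a == b) && (dist e x (enum_val a) == i))%:R.

Inductive terwilliger : MX -> Prop :=
| terw_A : terwilliger (dist_mx 1)
| terw_Estar i : (i <= diameter e)%N -> terwilliger (Estar i)
| terw_1 : terwilliger 1%:M
| terw_add B1 B2 : terwilliger B1 -> terwilliger B2 -> terwilliger (B1 + B2)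
| terw_scale a B : terwilliger B -> terwilliger (a *: B)
| terw_mul B1 B2 : terwilliger B1 -> terwilliger B2 -> terwilliger (B1 *m B2).

Definition herm (u w : V) : C := \sum_a u a 0 * (w a 0)^*.

Definition T_module (W : {vspace V}) :=
  forall B w, terwilliger B -> w \in W -> B *m w \in W.

Definition T_irreducible (W : {vspace V}) :=
  [/\ T_module W, W != 0%VS &
      forall W', T_module W' -> (W' <= W)%VS -> W' = 0%VS \/ W' = W].

Definition Estar_img (i : nat) (W : {vspace V}) : {vspace V} :=
  (linfun (mulmx (Estar i) : V -> V) @: W)%VS.

Definition thin (W : {vspace V}) := forall i, (\dim (Estar_img i W) <= 1)%N.

(* The least i <= D with E*_i W <> 0, for W <> 0. *)
Definition endpoint (W : {vspace V}) : nat :=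
  find (fun i => Estar_img i W != 0%VS) (iota 0 (diameter e).+1).

Definition local_mx : MX := Estar 2 *m dist_mx 2 *m Estar 2.

(* Thin irreducible module with endpoint 2 and local eigenvalue eta. *)
Definition thin2 (eta : C) (W : {vspace V}) :=
  [/\ T_irreducible W, thin W, endpoint W = 2%N &
      exists w, [/\ w \in Estar_img 2 W, w != 0 & local_mx *m w = eta *: w]].

Definition span_of (P : {vspace V} -> Prop) : set V :=
  [set v | exists s : seq {vspace V},
     (forall W, W \in s -> P W) /\ v \in (\sum_(W <- s) W)%VS].

(* The irreducible module with endpoint 0 is unique, so this span is V_0. *)
Definition V0 : set V := span_of (fun W => T_irreducible W /\ endpoint W = 0%N).

Definition Y : set V := span_of (fun W => T_irreducible W /\ endpoint W = 1%N).

Definition U : set V :=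
  [set u | (exists v : V, u = Estar 2 *m v) /\
     forall v y, V0 v -> Y y -> herm u (Estar 2 *m v + Estar 2 *m y) = 0].

Definition U_eta (eta : C) : set V :=
  [set u | U u /\ local_mx *m u = eta *: u].

Definition H_eta (eta : C) : set V := span_of (thin2 eta).

Definition T_iso (W W' : {vspace V}) :=
  exists f : 'End(V),
    [/\ (f @: W)%VS = W', (W :&: lker f)%VS = 0%VS &
        forall B w, terwilliger B -> w \in W -> f (B *m w) = B *m f w].

Definition orth_decomposition (s : seq {vspace V}) :=
  [/\ forall W, W \in s -> T_irreducible W,
      uniq s,
      forall W W', W \in s -> W' \in s -> W != W' ->
        forall w w', w \in W -> w' \in W' -> herm w w' = 0 &
      (\sum_(W <- s) W)%VS = fullv].

(* The number m below depends neither on the decomposition s (Krull-Schmidt)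
   nor on W (thin irreducible modules with endpoint 2 and the same local
   eigenvalue are isomorphic); it defaults to 0 if there is no such W. *)
Definition mu_eta (eta : C) : nat :=
  xget 0%N [set m | exists (s : seq {vspace V}) (W : {vspace V}),
    [/\ orth_decomposition s, thin2 eta W &
        m = count (fun W' => `[< T_iso W W' >]) s]].

(** * Local eigenvalues *)

Definition sphere2 : {set X} := [set y | dist e x y == 2%N]%SET.

Definition local_graph_mx : 'M[C]_#|sphere2| :=
  \matrix_(a, b) (dist e (enum_val a) (enum_val b) == 2%N)%:R.

(* eta_1, ..., eta_{k_2} are stored from index 0. *)
Definition local_eigenvalues (p : nat -> nat -> nat -> nat) (s : seq C) :=
  [/\ char_poly local_graph_mx = \prod_(a <- s) ('X - a%:P),
      s`_0 = (p 2%N 2%N 2%N)%:R &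
      forall i : nat, (0 < i < valency p)%N -> s`_i = (inter_b p 3)%:R - 1].

(* The count depends only on the multiset s, hence not on the choice of an
   ordering, and orderings exist when e is bipartite distance-regular with
   diameter >= 4 and valency >= 3. *)
Definition mult_eta (p : nat -> nat -> nat -> nat) (eta : C) : nat :=
  xget 0%N [set m | exists s : seq C,
    local_eigenvalues p s /\ m = count_mem eta (drop (valency p) s)].

End Terwilliger.

(* Main.v *)
(* The algebra T is closed under conjugate transpose, so V is an orthogonal sum of irreducible
   T-modules, and two irreducible modules are orthogonal or isomorphic.

   A vector v at level m spans with the vectors E*_(j+m) A_j v a T-module as soon as lowering
   each of them gives a multiple of the previous one. This describes the modules of endpoint 0
   and 1, whence U is the kernel of the lowering map on level 2; and for a thin module of
   endpoint 2 the lowering scalars obey a recurrence whose only datum is the local eigenvalue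
   eta, so eta determines the isomorphism class and mu_eta = dim E*_2 H_eta.

   On the orthogonal complement of U in E*_2 V, the image of the raising map from level 1, the
   local matrix has the eigenvalues p^2_22 (once) and b_3 - 1 (k - 1 times). As it is Hermitian,
   mult_eta = dim U_eta. Since E*_2 H_eta is contained in U_eta, (i) and (ii) are both the
   equality of dimensions. If every irreducible module of endpoint 2 is thin, projecting
   u in U_eta on an orthogonal decomposition gives (i). Conversely a nonthin one is orthogonal
   to every H_eta, so (i) would make its level 2 part orthogonal to all eigenvectors of the
   local matrix on E*_2 V. *)

Require Import Defs.
From mathcomp Require Import all_boot all_order all_algebra.
From mathcomp Require Import zify.
From mathcomp Require Import boolp classical_sets reals complex.

Set Implicit Arguments.
Unset Strict Implicit.
Unset Printing Implicit Defensive.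

Import Order.TTheory GRing.Theory Num.Theory.

Local Open Scope classical_set_scope.
Local Open Scope ring_scope.
Local Open Scope sesquilinear_scope.

(** * Distance *)

Section Distance.
Variables (X : finType) (e : rel X).
Hypotheses (he : simple_graph e) (hcon : graph_connected e).

Local Notation d := (dist e).

Lemma dist_spec y z :
  (d y z < #|X|)%N /\
  exists2 w : seq X, path e y w && (last y w == z) & size w = d y z.
Proof.
have [w0 pw0 ->] := connectP (hcon y z).
case: (shortenP pw0) => w pw uw _.
set P := (fun n => [exists w' : n.-tuple X, path e y w' && (last y w' == last y w)]).
have szw : (size w < #|X|)%N by have := max_card (mem (y :: w)); rewrite (card_uniqP uw).
have hasP : has P (iota 0 #|X|).
  apply/hasP; exists (size w); first by rewrite mem_iota.
  by apply/existsP; exists (in_tuple w); rewrite /= pw eqxx.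
have lt : (d y (last y w) < #|X|)%N by move: hasP; rewrite has_find size_iota.
split=> //; have := nth_find 0%N hasP; rewrite nth_iota // add0n.
by case/existsP=> w' hw'; exists w' => //; rewrite size_tuple.
Qed.

Lemma dist_le_walk y w : path e y w -> (d y (last y w) <= size w)%N.
Proof.
move=> pw; have [lt _] := dist_spec y (last y w).
case: (leqP #|X| (size w)) => [le|szw]; first exact: leq_trans (ltnW lt) le.
rewrite leqNgt; apply/negP => /(before_find 0%N); rewrite nth_iota // add0n.
by move/existsP; apply; exists (in_tuple w); rewrite /= pw eqxx.
Qed.

Lemma dist_walk y z :
  exists2 w : seq X, path e y w /\ last y w = z & size w = d y z.
Proof. by have [_ [w /andP[pw /eqP lw] sw]] := dist_spec y z; exists w. Qed.

Lemma dist_eq0 y z : (d y z == 0)%N = (y == z).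
Proof.
apply/eqP/eqP => [|<-].
  by have [w [_ <-] <-] := dist_walk y z; case: w.
by apply/eqP; rewrite -leqn0 (@dist_le_walk y [::]).
Qed.

Lemma distxx y : d y y = 0%N.
Proof. by apply/eqP; rewrite dist_eq0. Qed.

Lemma dist_tri w y z : (d y z <= d y w + d w z)%N.
Proof.
have [s [ps <-] <-] := dist_walk y w; have [t [pt <-] <-] := dist_walk (last y s) z.
by rewrite -last_cat -size_cat dist_le_walk // cat_path ps.
Qed.

Lemma dist_sym y z : d y z = d z y.
Proof.
suff le u v : (d u v <= d v u)%N by apply/eqP; rewrite eqn_leq !le.
have [s [ps <-] <-] := dist_walk v u.
have := ps; rewrite -rev_path => prev.
have {2}-> : v = last (last v s) (rev (belast v s)).
  by case: (s) => [|a t] //=; rewrite rev_cons last_rcons.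
rewrite -(size_belast v s) -size_rev dist_le_walk //.
by rewrite (eq_path (e' := fun a b => e b a)) // => a b; rewrite he.1.
Qed.

Lemma dist_eq1 y z : (d y z == 1)%N = e y z.
Proof.
apply/idP/idP => [/eqP|eyz].
  have [w [pw lw] <-] := dist_walk y z.
  by case: w pw lw => [|a [|b w]] //=; rewrite andbT => + <-.
rewrite eqn_leq lt0n dist_eq0 (_ : z = last y [:: z]) // dist_le_walk /= ?eyz //.
by apply: contraTneq eyz => ->; rewrite he.2.
Qed.

Lemma dist_pred y z n : d y z = n.+1 -> exists2 w, e w z & d y w = n.
Proof.
have [s [ps lz] sz] := dist_walk y z; rewrite -sz.
case/lastP: s ps lz sz => // s a; rewrite rcons_path last_rcons size_rcons.
case/andP=> ps eaz <- sz [ns]; exists (last y s); first by [].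
apply/eqP; rewrite eqn_leq -{1}ns dist_le_walk //= -ltnS -ns.
rewrite sz (leq_trans (dist_tri (last y s) _ _)) // addnC.
by move: eaz; rewrite -dist_eq1 => /eqP->.
Qed.

Lemma dist_le_diameter y z : (d y z <= diameter e)%N.
Proof.
exact: leq_trans (leq_bigmax (F := fun z => d y z) z)
                 (leq_bigmax (F := fun y => \max_(z : X) d y z) y).
Qed.

Lemma dist_realized (x0 : X) h :
  (h <= diameter e)%N -> exists y z, d y z = h.
Proof.
have X0 : (0 < #|X|)%N by apply/card_gt0P; exists x0.
have [y [z <-]] : exists y z, d y z = diameter e.
  rewrite /diameter; have [y ->] := @bigop.eq_bigmax X (fun y => \max_(z : X) d y z) X0.
  by have [z ->] := @bigop.eq_bigmax X (fun z => d y z) X0; exists y, z.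
move=> le; exists y; move: {2}(d y z - h)%N (erefl (d y z - h)%N) => n.
elim: n z le => [|n IH] z le E; first by exists z; lia.
have [m dm] : exists m, d y z = m.+1 by case: (d y z) E => // m; exists m.
have [w _ dw] := dist_pred dm; apply: (IH w); lia.
Qed.

Hypothesis hbip : bipartite e.

Lemma odd_dist_edge y z w : e y z -> odd (d w y) = ~~ odd (d w z).
Proof.
have [c hc] := hbip.
have par u v : odd (d u v) = (c u != c v).
  have [s [ps <-] <-] := dist_walk u v; elim: s u ps => [|a s IH] u /=.
    by rewrite eqxx.
  by case/andP=> /hc + /IH ->; case: (c u) (c a) (c (last a s)) => [] [] [].
by move=> /hc; rewrite !par; case: (c w) (c y) (c z) => [] [] [].
Qed.

Lemma dist_edge y z w : e y z -> d w y = (d w z).+1 \/ d w z = (d w y).+1.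
Proof.
move=> eyz; have odd := odd_dist_edge w eyz.
have := dist_tri y w z; have := dist_tri z w y.
have /eqP-> : d y z == 1%N by rewrite dist_eq1.
have /eqP-> : d z y == 1%N by rewrite dist_eq1 he.1.
have : d w y != d w z by apply: contra_eq_neq odd => ->; case: odd.
lia.
Qed.

Lemma odd_dist y z w : odd (d y z) = odd (d w y) (+) odd (d w z).
Proof.
have [s [ps <-] <-] := dist_walk y z; elim: s y ps => [|a s IH] y /=.
  by rewrite addbb.
by case/andP=> ea /IH ->; rewrite (odd_dist_edge w ea) addNb.
Qed.

End Distance.

(** * Intersection numbers *)

Section IntersectionNumbers.
Variables (X : finType) (e : rel X) (p : nat -> nat -> nat -> nat) (x0 : X).
Hypotheses (he : simple_graph e) (hbip : bipartite e).
Hypothesis hdr : distance_regular e p.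

Local Notation d := (dist e).
Let hcon : graph_connected e := hdr.1.

Lemma interE y z i j : #|[pred w | (d y w == i) && (d w z == j)]| = p (d y z) i j.
Proof. exact: hdr.2. Qed.

Lemma inter_sym h i j : (h <= diameter e)%N -> p h i j = p h j i.
Proof.
case/(dist_realized he hcon x0)=> y [z <-].
rewrite -(interE y z i j) (dist_sym he hcon y z) -interE.
by apply: eq_card => w; rewrite !inE (dist_sym he hcon w z) (dist_sym he hcon y w) andbC.
Qed.

Lemma inter_eq0 h m :
  (h <= diameter e)%N -> h.+1 != m -> h != m.+1 -> p h m 1%N = 0%N.
Proof.
case/(dist_realized he hcon x0)=> y [z <-] h1 h2.
rewrite -interE; apply: eq_card0 => w; rewrite !inE dist_eq1 //.
apply/negP => /andP[/eqP yw ewz].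
by have [H|H] := dist_edge he hcon hbip y ewz; move: h1 h2; rewrite -yw H eqxx.
Qed.

Lemma inter_c_gt0 h : (h < diameter e)%N -> (0 < p h.+1 h 1)%N.
Proof.
case/(dist_realized he hcon x0)=> y [z dz]; rewrite -dz -interE.
have [w ewz dw] := dist_pred he hcon dz.
by apply/card_gt0P; exists w; rewrite !inE dw eqxx dist_eq1.
Qed.

Lemma inter_b_gt0 h : (h < diameter e)%N -> (0 < p h h.+1 1)%N.
Proof.
case/(dist_realized he hcon x0)=> y [z dz].
have [w ewz dw] := dist_pred he hcon dz; rewrite -dw -interE.
by apply/card_gt0P; exists z; rewrite !inE dz dw eqxx dist_eq1 // he.1.
Qed.

Lemma card_neighbours z : #|[pred w | d z w == 1%N]| = valency p.
Proof.
have := interE z z 1 1; rewrite distxx // /valency => <-; apply: eq_card => w.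
by rewrite !inE (dist_sym he hcon w z) andbb.
Qed.

Lemma inter_cb h :
  (h < diameter e)%N -> (p h.+1 h 1 + p h.+1 h.+2 1)%N = valency p.
Proof.
case/(dist_realized he hcon x0)=> y [z dz]; rewrite -(card_neighbours z) -dz.
rewrite -!interE -cardUI [X in (_ + X)%N]eq_card0 ?addn0.
  apply: eq_card => w; rewrite !inE dz dist_eq1 // dist_eq1 // he.1.
  rewrite -andb_orl; case ewz: (e z w); rewrite ?andbF // andbT.
  by have [H|H] := dist_edge he hcon hbip y ewz; lia.
by move=> w; rewrite !inE dz; lia.
Qed.

Lemma inter101 : (0 < diameter e)%N -> p 1 0 1 = 1%N.
Proof.
case/(dist_realized he hcon x0)=> y [z dz]; have := interE y z 0 1; rewrite dz => <-.
rewrite -[RHS](card1 y); apply: eq_card => w; rewrite !inE dist_eq0 // [y == w]eq_sym.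
by case: eqVneq => // ->; rewrite dz.
Qed.

Variable C : numClosedFieldType.
Local Notation A := (dist_mx C e).

Lemma sum_enum_val (F : X -> C) :
  \sum_(a < #|X|) F (enum_val a) = \sum_w F w.
Proof. by rewrite -(big_enum_val F); apply: eq_bigl. Qed.

Lemma dist_mx_mulE i j a b :
  (A i *m A j) a b = (p (d (enum_val a) (enum_val b)) i j)%:R.
Proof.
rewrite mxE; under eq_bigr do rewrite !mxE -natrM mulnb.
rewrite (sum_enum_val (fun w => ((d (enum_val a) w == i) && (d w (enum_val b) == j))%:R)).
by rewrite -natr_sum -interE -sum1_card [in RHS]big_mkcond; congr _%:R.
Qed.

Lemma dist_mx0 : A 0 = 1%:M.
Proof.
by apply/matrixP => a b; rewrite !mxE dist_eq0 // (inj_eq enum_val_inj).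
Qed.

Lemma dist_mx_recr m :
  A 1 *m A m.+1 = (p m m.+1 1)%:R *: A m + (p m.+2 m.+1 1)%:R *: A m.+2.
Proof.
apply/matrixP => a b; rewrite dist_mx_mulE !mxE.
have := dist_le_diameter e (enum_val a) (enum_val b).
move: (d _ _) => h hD; rewrite inter_sym //.
have [->|hm] := eqVneq h m.
  by rewrite (_ : m == m.+2 = false) ?mulr0 ?addr0 ?mulr1 //; lia.
have [->|hm2] := eqVneq h m.+2; first by rewrite mulr0 add0r mulr1.
by rewrite inter_eq0 ?mulr0 ?addr0 //; lia.
Qed.

Lemma trmx_dist_mx m : (A m)^T = A m.
Proof. by apply/matrixP => a b; rewrite !mxE dist_sym. Qed.

Lemma conj_dist_mx m : map_mx Num.conj (A m) = A m.
Proof. by apply/matrixP => a b; rewrite !mxE conjC_nat. Qed.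

Lemma dist_mx_eq0 m : (diameter e < m)%N -> A m = 0.
Proof.
move=> lt; apply/matrixP => a b; rewrite !mxE.
by have := dist_le_diameter e (enum_val a) (enum_val b); case: eqP => // ->; lia.
Qed.

End IntersectionNumbers.

(** * The Hermitian form and modules *)

Section Hermitian.
Variables (C : numClosedFieldType) (X : finType).
Local Notation V := 'cV[C]_#|X|.
Local Notation MX := 'M[C]_#|X|.
Implicit Types (u v w : V) (U W : {vspace V}) (B : MX).

Definition adjmx B : MX := map_mx Num.conj B^T.

Lemma hermDl u v w : herm (u + v) w = herm u w + herm v w.
Proof. by rewrite -big_split; apply: eq_bigr => a _; rewrite mxE mulrDl. Qed.

Lemma hermZl c u w : herm (c *: u) w = c * herm u w.
Proof. by rewrite mulr_sumr; apply: eq_bigr => a _; rewrite mxE mulrA. Qed.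

Lemma herm_conj u w : herm u w = (herm w u)^*.
Proof. by rewrite rmorph_sum; apply: eq_bigr => a _; rewrite rmorphM /= conjCK mulrC. Qed.

Lemma hermDr u v w : herm w (u + v) = herm w u + herm w v.
Proof. by rewrite herm_conj hermDl rmorphD /= -!herm_conj. Qed.

Lemma hermZr c u w : herm w (c *: u) = c^* * herm w u.
Proof. by rewrite herm_conj hermZl rmorphM /= -herm_conj. Qed.

Lemma herm0l w : herm 0 w = 0.
Proof. by rewrite -(scale0r (0 : V)) hermZl mul0r. Qed.

Lemma herm0r w : herm w 0 = 0.
Proof. by rewrite herm_conj herm0l rmorph0. Qed.

Lemma herm_suml I (r : seq I) (P : pred I) (F : I -> V) w :
  herm (\sum_(i <- r | P i) F i) w = \sum_(i <- r | P i) herm (F i) w.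
Proof. exact: (big_morph (fun u => herm u w) (fun u v => hermDl u v w) (herm0l w)). Qed.

Lemma herm_eq0 u : (herm u u == 0) = (u == 0).
Proof.
apply/idP/eqP => [|->]; last by rewrite herm0l.
rewrite psumr_eq0 => [/allP h|a _]; last exact: mul_conjC_ge0.
apply/colP => a; rewrite mxE; apply/eqP.
by rewrite -mul_conjC_eq0; apply: (implyP (h a _)) => //; rewrite mem_index_enum.
Qed.

Lemma herm_mulmx B u w : herm (B *m u) w = herm u (adjmx B *m w).
Proof.
rewrite /herm; under eq_bigr do rewrite mxE mulr_suml.
rewrite exchange_big; apply: eq_bigr => b _ /=.
rewrite mxE rmorph_sum mulr_sumr; apply: eq_bigr => a _ /=.
by rewrite !mxE rmorphM /= conjCK mulrCA mulrA.
Qed.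

Definition dual_mx W : 'M[C]_(\dim W, #|X|) :=
  \matrix_(i, a) ((vbasis W)`_i a 0)^*.

Definition perp W : {vspace V} :=
  lker (linfun (mulmx (dual_mx W))).

Lemma perpP W v : reflect (forall w, w \in W -> herm v w = 0) (v \in perp W).
Proof.
rewrite memv_ker lfunE /=; apply: (iffP eqP) => [h w wW|h].
  rewrite herm_conj (coord_vbasis wW) herm_suml big1 ?rmorph0 // => i _.
  rewrite hermZl herm_conj; move/colP/(_ i): h; rewrite !mxE => h.
  rewrite (_ : herm v _ = 0) ?rmorph0 ?mulr0 // -[RHS]h.
  by apply: eq_bigr => a _; rewrite mxE mulrC.
apply/colP => i; rewrite !mxE.
rewrite -[RHS](h (vbasis W)`_i) ?vbasis_mem ?mem_nth ?size_tuple //.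
by apply: eq_bigr => a _; rewrite mxE mulrC.
Qed.

Lemma cap_perp W : (W :&: perp W = 0)%VS.
Proof.
apply/eqP; rewrite -subv0; apply/subvP => v /memv_capP[vW /perpP/(_ v vW)/eqP].
by rewrite herm_eq0 memv0.
Qed.

Lemma add_perp W : (W + perp W = fullv)%VS.
Proof.
apply/eqP; rewrite eqEdim subvf /= (dimv_disjoint_sum (cap_perp W)).
rewrite -(limg_ker_dim (linfun (mulmx (dual_mx W) : V -> _)) fullv).
rewrite capfv addnC leq_add2r.
by rewrite (leq_trans (dimvS (subvf _))) // dimvf /dim /= muln1.
Qed.

Lemma perp_sym U W : (U <= perp W)%VS = (W <= perp U)%VS.
Proof.
by apply/subvP/subvP => h w wW; apply/perpP => u uU; rewrite herm_conj;
  have /perpP-> := h u uU; rewrite ?rmorph0.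
Qed.

Lemma subv_sumsP (I : eqType) (r : seq I) (F : I -> {vspace V}) U :
  reflect (forall i, i \in r -> (F i <= U)%VS) (\sum_(i <- r) F i <= U)%VS.
Proof.
elim: r => [|i r IH]; first by rewrite big_nil sub0v; apply: ReflectT.
rewrite big_cons subv_add; apply: (iffP andP) => [[Fi /IH Fr] j|h].
  by rewrite inE => /orP[/eqP->|/Fr].
by split; [apply: h; rewrite inE eqxx | apply/IH => j jr; apply: h; rewrite inE jr orbT].
Qed.

Lemma sumv_seq_sup (I : eqType) (r : seq I) (F : I -> {vspace V}) i :
  i \in r -> (F i <= \sum_(i <- r) F i)%VS.
Proof. by move=> ir; have /subv_sumsP := subvv (\sum_(i <- r) F i)%VS; apply. Qed.

Lemma dim_orth_sum (I : eqType) (r : seq I) (F : I -> {vspace V}) :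
  uniq r -> {in r &, forall i j, i != j -> (F i <= perp (F j))%VS} ->
  \dim (\sum_(i <- r) F i)%VS = (\sum_(i <- r) \dim (F i))%N.
Proof.
elim: r => [|i r IH] /=; first by rewrite !big_nil dimv0.
case/andP=> ir ur h; rewrite !big_cons dimv_disjoint_sum ?IH //.
  by move=> j k jr kr; apply: h; rewrite inE ?jr ?kr orbT.
apply/eqP; rewrite -subv0 -[X in (_ <= X)%VS](cap_perp (F i)) capvS //.
apply/subv_sumsP => j jr; apply: h; rewrite ?inE ?eqxx ?jr ?orbT //.
by apply: contraNneq ir => <-.
Qed.

Lemma mem_sumsP (I : eqType) (r : seq I) (F : I -> {vspace V}) v :
  v \in (\sum_(i <- r) F i)%VS ->
  exists2 f : I -> V, (forall i, i \in r -> f i \in F i) & uniq r -> v = \sum_(i <- r) f i.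
Proof.
elim: r v => [|i r IH] v.
  by rewrite big_nil memv0 => /eqP->; exists (fun _ => 0) => // _; rewrite big_nil.
rewrite big_cons => /memv_addP[a aF [b /IH [f fF bE] ->]].
have [ir|ir] := boolP (i \in r).
  by exists f => [j|/=]; rewrite ?ir // inE => /orP[/eqP->|]; apply: fF.
exists (fun j => if j == i then a else f j) => [j|/= /andP[_ ur]].
  by rewrite inE; case: eqVneq => [->|_ /fF].
rewrite big_cons eqxx bE //; congr (_ + _); apply: eq_big_seq => j jr.
by case: eqVneq ir => // <-; rewrite jr.
Qed.

End Hermitian.

Section Modules.
Variables (C : numClosedFieldType) (X : finType) (e : rel X) (x : X).
Variable (p : nat -> nat -> nat -> nat).
Hypotheses (he : simple_graph e) (hbip : bipartite e).
Hypothesis hdr : distance_regular e p.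
Local Notation V := 'cV[C]_#|X|.
Local Notation MX := 'M[C]_#|X|.
Local Notation T := (@terwilliger C X e x).
Local Notation E := (Estar C e x).
Local Notation A := (dist_mx C e).
Local Notation D := (diameter e).
Implicit Types (u v w : V) (U W M N : {vspace V}) (B : MX).

Lemma Estar_mulE i v a : (E i *m v) a 0 = (dist e x (enum_val a) == i)%:R * v a 0.
Proof.
rewrite mxE (bigD1 a) //= big1 ?addr0 ?mxE ?eqxx // => b /negPf ba.
by rewrite mxE eq_sym ba mul0r.
Qed.

Lemma Estar_mulmx i j v : E i *m (E j *m v) = if i == j then E i *m v else 0.
Proof.
apply/colP => a; rewrite !Estar_mulE; case: (eqVneq i j) => [->|ij].
  by rewrite /= Estar_mulE mulrA -natrM mulnb andbb.
rewrite /= mulrA -natrM mulnb mxE; case: (_ =P i) => [->|] /=; last by rewrite mul0r.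
by rewrite (negPf ij) mul0r.
Qed.

Lemma EstarK i v : E i *m (E i *m v) = E i *m v.
Proof. by rewrite Estar_mulmx eqxx. Qed.

Lemma Estar_eq0 i v : (D < i)%N -> E i *m v = 0.
Proof.
move=> lt; apply/colP => a; rewrite Estar_mulE mxE.
by have := dist_le_diameter e x (enum_val a); case: eqP => [->|]; rewrite ?mul0r //; lia.
Qed.

Lemma sum_Estar v : \sum_(i < D.+1) E i *m v = v.
Proof.
apply/colP => a; rewrite summxE; under eq_bigr do rewrite Estar_mulE.
have le : (dist e x (enum_val a) < D.+1)%N by rewrite ltnS dist_le_diameter.
rewrite (bigD1 (Ordinal le)) //= eqxx mul1r big1 ?addr0 // => i.
by rewrite -val_eqE /= eq_sym => /negPf->; rewrite mul0r.
Qed.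

Lemma terw_EstarT i : T (E i).
Proof.
have [le|lt] := leqP i D; first exact: terw_Estar.
rewrite (_ : E i = 0 *: 1%:M); first exact/terw_scale/terw_1.
rewrite scale0r; apply/matrixP => a b; rewrite !mxE.
by have := dist_le_diameter e x (enum_val a); case: (a == b) => //=; case: eqP => // ->; lia.
Qed.

Lemma terw_dist m : T (A m).
Proof.
suff: T (A m) /\ T (A m.+1) by case.
elim: m => [|m [Tm Tm1]]; first by rewrite (dist_mx0 hdr); split; [exact: terw_1 | exact: terw_A].
split=> //; have [lt|le] := ltnP m.+1 D; last first.
  by rewrite dist_mx_eq0 // -(scale0r 1%:M); exact/terw_scale/terw_1.
have c0 : ((p m.+2 m.+1 1)%:R : C) != 0.
  by rewrite pnatr_eq0 -lt0n (inter_c_gt0 (p := p) x he).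
have -> : A m.+2 = (p m.+2 m.+1 1)%:R^-1 *:
    (A 1 *m A m.+1 + (- (p m m.+1 1)%:R) *: A m).
  rewrite (dist_mx_recr x he hbip hdr) scaleNr addrAC subrr add0r scalerA mulVf //.
  by rewrite scale1r.
apply/terw_scale/terw_add; last exact: terw_scale.
exact/terw_mul/Tm1/terw_A.
Qed.

Lemma adjmx_Estar i : adjmx (E i) = E i.
Proof.
apply/matrixP => a b; rewrite !mxE conjC_nat eq_sym.
by case: eqVneq => // ->.
Qed.

Lemma adjmx_dist m : adjmx (A m) = A m.
Proof. by rewrite /adjmx (trmx_dist_mx he hdr) conj_dist_mx. Qed.

Lemma terw_adj B : T B -> T (adjmx B).
Proof.
elim=> [|i le||B1 B2 _ T1 _ T2|a B1 _ T1|B1 B2 _ T1 _ T2].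
- by rewrite adjmx_dist; exact: terw_A.
- by rewrite adjmx_Estar; exact: terw_Estar.
- by rewrite /adjmx trmx1 map_mx1; exact: terw_1.
- by rewrite /adjmx linearD map_mxD; exact: terw_add.
- by rewrite /adjmx linearZ map_mxZ; exact: terw_scale.
- by rewrite /adjmx trmx_mul map_mxM; exact: terw_mul.
Qed.

Lemma T_module_gen W :
  (forall w, w \in W -> A 1 *m w \in W) -> (forall i w, w \in W -> E i *m w \in W) ->
  T_module e x W.
Proof.
move=> hA hE B w TB; elim: TB w => [|i le||B1 B2 _ T1 _ T2|a B1 _ T1|B1 B2 _ T1 _ T2] w wW.
- exact: hA.
- exact: hE.
- by rewrite mul1mx.
- by rewrite mulmxDl memvD ?T1 ?T2.
- by rewrite -scalemxAl memvZ ?T1.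
- by rewrite -mulmxA T1 ?T2.
Qed.

Lemma T_module_perp W : T_module e x W -> T_module e x (perp W).
Proof.
move=> hW B v TB /perpP h; apply/perpP => w wW.
by rewrite herm_mulmx h // hW //; exact: terw_adj.
Qed.

Lemma T_module_cap W M : T_module e x W -> T_module e x M -> T_module e x (W :&: M)%VS.
Proof.
by move=> hW hM B v TB /memv_capP[vW vM]; rewrite memv_cap hW ?hM.
Qed.

Lemma exists_irreducible M : T_module e x M -> M != 0%VS ->
  exists2 W, T_irreducible e x W & (W <= M)%VS.
Proof.
elim: {M}(\dim M) {-2}M (leqnn (\dim M)) => [|n IH] M.
  by rewrite leqn0 dimv_eq0 => /eqP-> _; rewrite eqxx.
move=> dM hM M0.
case: (pselect (exists N, [/\ T_module e x N, (N <= M)%VS, N != 0%VS & N != M])).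
  case=> N [hN NM N0 NnM]; have [|W hW WN] := IH N _ hN N0.
    rewrite -ltnS; apply: leq_trans dM; rewrite ltnNge; apply: contra NnM => le.
    by rewrite eqEdim NM.
  by exists W => //; exact: subv_trans NM.
move=> h; exists M => //; split=> // N hN NM.
have [->|N0] := eqVneq N 0%VS; first by left.
by right; apply/eqP; apply/negPn/negP => NnM; apply: h; exists N.
Qed.

End Modules.

(** * Semisimplicity *)

Section Semisimple.
Variables (C : numClosedFieldType) (X : finType) (e : rel X) (x : X).
Variable (p : nat -> nat -> nat -> nat).
Hypotheses (he : simple_graph e) (hbip : bipartite e).
Hypothesis hdr : distance_regular e p.
Local Notation V := 'cV[C]_#|X|.
Local Notation MX := 'M[C]_#|X|.
Local Notation T := (@terwilliger C X e x).
Local Notation E := (Estar C e x).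
Local Notation D := (diameter e).
Implicit Types (u v w : V) (U W M N : {vspace V}) (B : MX).

Lemma exists_orth_decomposition M : T_module e x M ->
  exists s : seq {vspace V},
    [/\ forall W, W \in s -> T_irreducible e x W, uniq s,
        {in s &, forall W W', W != W' -> (W <= perp W')%VS} &
        (\sum_(W <- s) W)%VS = M].
Proof.
elim: {M}(\dim M).+1 {-2}M (leqnn (\dim M).+1) => [//|n IH] M dM hM.
have [->|M0] := eqVneq M 0%VS; first by exists [::]; rewrite big_nil; split.
have [W hW WM] := exists_irreducible hM M0; have [TW W0 _] := hW.
have TM' : T_module e x (M :&: perp W)%VS.
  by apply: T_module_cap => //; apply: T_module_perp he hdr _ TW.
have capW : (W :&: (M :&: perp W) = 0)%VS.
  by rewrite capvA (capv_idPl WM) cap_perp.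
have sumW : (W + (M :&: perp W) = M)%VS.
  by rewrite capvC vspace_modl // add_perp capfv.
have [|s [irr us orth sums]] := IH _ _ TM'.
  rewrite -ltnS; apply: leq_trans dM; rewrite ltnS -[X in (_ < \dim X)%N]sumW.
  by rewrite dimv_disjoint_sum // -[X in (X < _)%N]add0n ltn_add2r lt0n dimv_eq0.
have perpW W' : W' \in s -> (W' <= perp W)%VS.
  move=> W's; apply: subv_trans (capvSr M _); rewrite -sums.
  exact: (sumv_seq_sup id).
exists (W :: s); split=> [W'||W1 W2|].
- by rewrite inE => /orP[/eqP->|/irr].
- rewrite /= us andbT; apply: contra W0 => /perpW WW.
  by rewrite -subv0 -(cap_perp W) subv_cap subvv.
- rewrite !inE => /orP[/eqP->|W1s] /orP[/eqP->|W2s]; rewrite ?eqxx //.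
  + by rewrite perp_sym perpW.
  + by rewrite perpW.
  + exact: orth.
- by rewrite big_cons sums.
Qed.

Lemma schur W W' : T_irreducible e x W -> T_irreducible e x W' ->
  (W <= perp W')%VS \/ T_iso e x W W'.
Proof.
move=> [TW W0 irrW] [TW' W'0 irrW'].
set f := daddv_pi W' (perp W').
have fE v : v = f v + daddv_pi (perp W') W' v.
  by rewrite daddv_pi_add ?cap_perp // add_perp memvf.
have fid v : v \in W' -> f v = v by apply: daddv_pi_id; rewrite cap_perp.
have f0 v : v \in perp W' -> f v = 0.
  move=> vW; apply/eqP; rewrite -memv0 -(cap_perp W') memv_cap memv_pi /=.
  have -> : f v = v - daddv_pi (perp W') W' v by rewrite {2}[v]fE addrK.
  by rewrite memvB ?memv_pi.
have Tp := T_module_perp he hdr TW'.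
have fB B v : T B -> f (B *m v) = B *m f v.
  move=> TB; rewrite {1}[v]fE mulmxDr linearD /=.
  rewrite (fid (B *m f v)); last by apply: TW'; rewrite ?memv_pi.
  by rewrite (f0 (B *m _)) ?addr0 //; apply: Tp; rewrite ?memv_pi.
have Tker : T_module e x (W :&: lker f)%VS.
  move=> B w TB /memv_capP[wW]; rewrite memv_ker => /eqP fw.
  by rewrite memv_cap TW // memv_ker fB // fw mulmx0 eqxx.
have Timg : T_module e x (f @: W)%VS.
  move=> B w TB /memv_imgP[v vW ->]; rewrite -fB //.
  by apply: memv_img; apply: TW.
case: (irrW _ Tker (capvSl _ _)) => [k0|kW]; last first.
  left; apply/subvP => w wW; rewrite [w]fE; have := wW.
  by rewrite -{1}kW memv_cap memv_ker => /andP[_ /eqP->]; rewrite add0r memv_pi.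
right; exists f; split=> //; last by move=> B w TB _; rewrite fB.
have [|i0|//] := irrW' _ Timg.
  by apply/subvP => _ /memv_imgP[v _ ->]; rewrite memv_pi.
by case/eqP: W0; apply/eqP; rewrite -dimv_eq0 -(limg_dim_eq k0) i0 dimv0.
Qed.

Lemma Estar_imgP i W v : T_module e x W ->
  reflect (v \in W /\ E i *m v = v) (v \in Estar_img e x i W).
Proof.
move=> TW; apply: (iffP memv_imgP) => [[w wW]|[vW vE]].
  rewrite lfunE /= => ->; rewrite EstarK; split=> //.
  by apply: TW => //; exact: terw_EstarT.
by exists v => //; rewrite lfunE.
Qed.

Lemma mem_Estar_img i W w : w \in W -> E i *m w \in Estar_img e x i W.
Proof. by move=> wW; apply/memv_imgP; exists w => //; rewrite lfunE. Qed.

Lemma T_iso_dim_Estar i W W' : T_module e x W -> T_iso e x W W' ->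
  \dim (Estar_img e x i W) = \dim (Estar_img e x i W').
Proof.
move=> TW [f [<- k0 fB]]; have -> : Estar_img e x i (f @: W) = (f @: Estar_img e x i W)%VS.
  apply/vspaceP => v; apply/memv_imgP/memv_imgP => -[w].
    case/memv_imgP=> u uW ->; rewrite lfunE /= => ->.
    exists (E i *m u); first exact: mem_Estar_img.
    by rewrite fB //; exact: terw_EstarT.
  case/memv_imgP=> u uW ->; rewrite lfunE /= => ->.
  exists (f u); first exact: memv_img.
  by rewrite lfunE /= fB //; exact: terw_EstarT.
apply/esym/limg_dim_eq/eqP; rewrite -subv0 -[X in (_ <= X)%VS]k0 capvS //.
by apply/subvP => v /(Estar_imgP _ _ TW) [].
Qed.

Lemma T_iso_thin W W' : T_module e x W -> T_iso e x W W' -> thin e x W -> thin e x W'.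
Proof. by move=> TW iso h i; rewrite -(T_iso_dim_Estar i TW iso). Qed.

Lemma T_iso_endpoint W W' : T_module e x W -> T_iso e x W W' ->
  endpoint e x W' = endpoint e x W.
Proof.
move=> TW iso; apply: eq_find => i.
by rewrite -!dimv_eq0 (T_iso_dim_Estar i TW iso).
Qed.

Lemma endpointP W : T_irreducible e x W ->
  [/\ (endpoint e x W <= D)%N, Estar_img e x (endpoint e x W) W != 0%VS &
      forall i w, (i < endpoint e x W)%N -> w \in W -> E i *m w = 0].
Proof.
case=> TW W0 _; set P := fun i => Estar_img e x i W != 0%VS.
have PT : has P (iota 0 D.+1).
  apply: contraNT W0 => /hasPn h; rewrite -subv0; apply/subvP => w wW.
  rewrite memv0 -(sum_Estar e x w); apply/eqP/big1 => i _.
  have E0 : Estar_img e x i W = 0%VS by apply/eqP/negbNE/h; rewrite mem_iota /= add0n.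
  by have := mem_Estar_img i wW; rewrite E0 memv0 => /eqP.
have lt : (endpoint e x W < D.+1)%N by move: PT; rewrite has_find size_iota.
have := nth_find 0%N PT; rewrite nth_iota // add0n => hP; split=> // i w li wW.
have := before_find 0%N li; rewrite nth_iota ?add0n; last exact: ltn_trans lt.
by move/negbFE/eqP => E0; have := mem_Estar_img i wW; rewrite E0 memv0 => /eqP.
Qed.

Lemma terw_local : T (local_mx C e x).
Proof.
apply: terw_mul; last exact: terw_EstarT.
apply: terw_mul; first exact: terw_EstarT.
exact: terw_dist he hbip hdr 2.
Qed.

Lemma T_iso_thin2 eta W W' : thin2 e x eta W -> T_irreducible e x W' ->
  T_iso e x W W' -> thin2 e x eta W'.
Proof.
case=> irrW tW eW [w [wE w0 lw]] irrW' iso; have [TW _ _] := irrW.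
split=> //; first exact: T_iso_thin iso tW.
  by rewrite (T_iso_endpoint TW iso).
have [wW wE2] := Estar_imgP _ _ TW wE.
case: iso => f [fW k0 fB]; exists (f w); split.
- apply/Estar_imgP; first by case: irrW'.
  by rewrite -fW memv_img // -fB ?wE2 //; exact: terw_EstarT.
- by apply: contraNneq w0 => fw; rewrite -memv0 -k0 memv_cap wW memv_ker fw eqxx.
- by rewrite -fB ?lw ?linearZ //; exact: terw_local.
Qed.

End Semisimple.

(** * Levels and chains *)

Section Levels.
Variables (C : numClosedFieldType) (X : finType) (e : rel X) (x : X).
Variable (p : nat -> nat -> nat -> nat).
Hypotheses (he : simple_graph e) (hbip : bipartite e).
Hypothesis hdr : distance_regular e p.
Local Notation V := 'cV[C]_#|X|.
Local Notation MX := 'M[C]_#|X|.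
Local Notation E := (Estar C e x).
Local Notation A := (dist_mx C e).
Local Notation D := (diameter e).
Local Notation d := (dist e).
Implicit Types (u v w : V) (U W M N : {vspace V}) (B : MX).
Let hcon : graph_connected e := hdr.1.

Lemma Estar_distE i j m v a : E m *m v = v ->
  (E i *m (A j *m v)) a 0 =
  \sum_b ([&& d x (enum_val a) == i, d (enum_val a) (enum_val b) == j &
             d x (enum_val b) == m])%:R * v b 0.
Proof.
move=> vE; rewrite Estar_mulE mxE mulr_sumr; apply: eq_bigr => b _.
rewrite -{1}vE Estar_mulE mxE; case: (_ == i); rewrite ?mul0r // mul1r.
by case: (_ == j); rewrite ?mul0r // mul1r.
Qed.

Lemma Estar_dist_eq0 i j m v : E m *m v = v ->
  [|| i + m < j, i + j < m, j + m < i | odd (i + j + m)]%N ->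
  E i *m (A j *m v) = 0.
Proof.
move=> vE h; apply/colP => a; rewrite (Estar_distE i j a vE) mxE.
apply: big1 => b _.
case: and3P => [[/eqP xa /eqP ab /eqP xb]|]; last by rewrite mul0r.
have t1 := dist_tri hcon x (enum_val a) (enum_val b).
have t2 := dist_tri hcon (enum_val a) x (enum_val b).
have t3 := dist_tri hcon (enum_val b) x (enum_val a).
rewrite (dist_sym he hcon (enum_val a) x) xa ab xb in t1.
rewrite xa ab xb in t2.
rewrite (dist_sym he hcon (enum_val b)) xa ab xb in t3.
have := odd_dist hcon hbip (enum_val a) (enum_val b) x; rewrite xa ab xb => par.
by move: h; rewrite !oddD par; case: (odd i) (odd m) => [] []; lia.
Qed.

Lemma level_edge y z : e y z ->
  (d x z == (d x y).+1)%:R + (if d x y is i.+1 then (d x z == i)%:R else 0) = 1 :> C.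
Proof.
move=> eyz; case: (dist_edge he hcon hbip x eyz) => [->|->].
  by rewrite eqxx (_ : (_ == _) = false) ?add0r //; lia.
rewrite eqxx; case: (d x y) => [|i]; rewrite ?addr0 //.
by rewrite (_ : (_ == _) = false) ?addr0 //; lia.
Qed.

Lemma Estar_A i u :
  E i *m (A 1 *m u) = E i *m (A 1 *m (E i.+1 *m u)) +
    (if i is i'.+1 then E i *m (A 1 *m (E i' *m u)) else 0).
Proof.
apply/colP => a.
have -> : (E i *m (A 1 *m (E i.+1 *m u)) +
    (if i is i'.+1 then E i *m (A 1 *m (E i' *m u)) else 0)) a 0 =
  (d x (enum_val a) == i)%:R * \sum_b A 1 a b *
    (((d x (enum_val b) == i.+1)%:R +
      (if i is i'.+1 then (d x (enum_val b) == i')%:R else 0)) * u b 0).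
  rewrite [LHS]mxE; case: (i) => [|i'].
    rewrite [(0 : V) _ _]mxE addr0 Estar_mulE mxE; congr (_ * _).
    by apply: eq_bigr => b _; rewrite Estar_mulE addr0.
  rewrite !Estar_mulE -mulrDr ![(A 1 *m _) _ _]mxE -big_split; congr (_ * _).
  by apply: eq_bigr => b _; rewrite /= !Estar_mulE -mulrDr -mulrDl.
rewrite Estar_mulE; case: eqP => [<-|_]; last by rewrite !mul0r.
rewrite !mul1r [LHS]mxE; apply: eq_bigr => b _; rewrite mxE dist_eq1 //.
by case eab: (e _ _); [rewrite level_edge // !mul1r | rewrite !mul0r].
Qed.

Lemma A_Estar i v : E i *m v = v -> A 1 *m v =
  E i.+1 *m (A 1 *m v) + (if i is i'.+1 then E i' *m (A 1 *m v) else 0).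
Proof.
move=> vE; apply/colP => a.
have -> : (E i.+1 *m (A 1 *m v) + (if i is i'.+1 then E i' *m (A 1 *m v) else 0)) a 0 =
  \sum_b ((d x (enum_val a) == i.+1)%:R +
    (if i is i'.+1 then (d x (enum_val a) == i')%:R else 0)) * (A 1 a b * v b 0).
  rewrite -mulr_sumr; case: (i) => [|i']; rewrite [LHS]mxE.
    by rewrite [(0 : V) _ _]mxE !addr0 Estar_mulE mxE.
  by rewrite !Estar_mulE -mulrDl mxE.
rewrite mxE; apply: eq_bigr => b _.
rewrite -{1 2}vE Estar_mulE.
have [<-|_] := eqVneq (d x (enum_val b)) i; last by rewrite mul0r !mulr0.
rewrite mxE dist_eq1 //.
case eab: (e _ _); last by rewrite !mul0r mulr0.
by rewrite level_edge ?mul1r ?mulr1 // he.1.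
Qed.

Lemma level_recr i j v :
  E i.+1 *m (A 1 *m (E i.+2 *m (A j.+1 *m v))) +
  E i.+1 *m (A 1 *m (E i *m (A j.+1 *m v))) =
  (p j j.+1 1)%:R *: (E i.+1 *m (A j *m v)) +
  (p j.+2 j.+1 1)%:R *: (E i.+1 *m (A j.+2 *m v)).
Proof.
rewrite -(Estar_A i.+1) (mulmxA (A 1) (A j.+1) v) (dist_mx_recr x he hbip hdr).
by rewrite mulmxDl mulmxDr -!scalemxAl -!scalemxAr.
Qed.

Lemma level0_recr j v :
  E 0 *m (A 1 *m (E 1 *m (A j.+1 *m v))) =
  (p j j.+1 1)%:R *: (E 0 *m (A j *m v)) +
  (p j.+2 j.+1 1)%:R *: (E 0 *m (A j.+2 *m v)).
Proof.
have := Estar_A 0 (A j.+1 *m v); rewrite addr0 => <-; rewrite (mulmxA (A 1) (A j.+1) v).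
rewrite (dist_mx_recr x he hbip hdr).
by rewrite mulmxDl mulmxDr -!scalemxAl -!scalemxAr.
Qed.

(* By bipartiteness the distances between levels m and j + m are j, j + 2, ..., j + 2m, so this is
   a component of J v = 0. *)
Lemma level_sum m j v : E m *m v = v -> \sum_a v a 0 = 0 ->
  \sum_(l < m.+1) E (j + m) *m (A (j + l.*2) *m v) = 0.
Proof.
move=> vE v0; apply/colP => a; rewrite summxE mxE.
under eq_bigr do rewrite (Estar_distE _ _ a vE).
rewrite exchange_big /=.
transitivity ((d x (enum_val a) == j + m)%N%:R * \sum_b v b 0); last by rewrite v0 mulr0.
rewrite mulr_sumr.
apply: eq_bigr => b _; rewrite -mulr_suml.
have := Estar_mulE e x m v b; rewrite vE => ->.
have [xb|_] := eqVneq (d x (enum_val b)) m; last by rewrite mul0r !mulr0.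
rewrite mul1r; congr (_ * _).
have [xa|_] := eqVneq (d x (enum_val a)) (j + m)%N; last by rewrite big1.
have t1 := dist_tri hcon x (enum_val a) (enum_val b).
have t2 := dist_tri hcon (enum_val b) x (enum_val a).
rewrite (dist_sym he hcon (enum_val a) x) xa xb in t1.
rewrite (dist_sym he hcon (enum_val b)) xa xb in t2.
have := odd_dist hcon hbip (enum_val a) (enum_val b) x; rewrite xa xb => par.
move: par t1 t2; move: (d (enum_val a) _) => h par t1 t2.
have hh : h = (j + (h - j)./2.*2)%N.
  have ev : ~~ odd (h - j).
    by rewrite oddB; [rewrite par oddD; case: (odd j) (odd m) => [] [] | lia].
  by rewrite even_halfK //; lia.
have lt : ((h - j)./2 < m.+1)%N by lia.
rewrite (bigD1 (Ordinal lt)) //= -hh eqxx big1 ?addr0 // => l.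
rewrite -val_eqE /= => ne; rewrite (_ : (h == _) = false) //.
by apply: contraNF ne => /eqP heq; apply/eqP; lia.
Qed.

Lemma sum_coord_eq0 m v : E m *m v = v -> E 0 *m (A m *m v) = 0 -> \sum_a v a 0 = 0.
Proof.
move=> vE /colP/(_ (enum_rank x)); rewrite (Estar_distE _ _ _ vE) mxE => h.
rewrite -[RHS]h; apply: eq_bigr => b _; rewrite enum_rankK distxx // eqxx /=.
by rewrite andbb -{1}vE Estar_mulE.
Qed.

Section Chain.
Variables (m : nat) (v : V).
Hypothesis vE : E m *m v = v.
Hypothesis D_gt0 : (0 < D)%N.

(* A nonzero multiple of the j-fold raising of v while j < D, by chain_raise. *)
Definition chain (j : nat) : V := E (j + m) *m (A j *m v).

Lemma chainE j : chain j = E (j + m) *m (A j *m v).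
Proof. by []. Qed.

Lemma Estar_chain j : E (j + m) *m chain j = chain j.
Proof. exact: EstarK. Qed.

Lemma chain0 : chain 0 = v.
Proof. by rewrite /chain (dist_mx0 hdr) mul1mx. Qed.

Lemma chain_raise j :
  E (j + m).+1 *m (A 1 *m chain j) = (p j.+1 j 1)%:R *: chain j.+1.
Proof.
case: j => [|j].
  by rewrite chain0 (inter101 x he hdr) ?scale1r.
have := level_recr (j.+1 + m) j v.
rewrite (Estar_dist_eq0 (i := (j.+1 + m).+2) vE); last by lia.
rewrite (Estar_dist_eq0 (i := (j.+1 + m).+1) (j := j) vE); last by lia.
by rewrite !mulmx0 add0r scaler0 add0r.
Qed.

Lemma chain_mem W j : T_module e x W -> v \in W -> chain j \in W.
Proof.
move=> TW vW; apply: (TW _ _ (terw_EstarT _ _ _ _)).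
by apply: TW => //; exact: terw_dist he hbip hdr j.
Qed.

Hypothesis low : forall i, i.+1 = m -> E i *m (A 1 *m v) = 0.
Variable xs : nat -> C.
Hypothesis hx : forall j, E (j + m) *m (A 1 *m chain j.+1) = xs j *: chain j.

Definition chain_span : {vspace V} := (\sum_(j < D.+1) <[chain j]>)%VS.

Lemma A_chain0 : A 1 *m chain 0 = (p 1 0 1)%:R *: chain 1.
Proof.
have h := chain_raise 0; rewrite chain0 add0n in h *; rewrite (A_Estar vE) h.
suff -> : (if m is i.+1 then E i *m (A 1 *m v) else 0) = 0 by rewrite addr0.
by case: (m) low => [|i] // low'; exact: low'.
Qed.

Lemma A_chainS j :
  A 1 *m chain j.+1 = (p j.+2 j.+1 1)%:R *: chain j.+2 + xs j *: chain j.
Proof. by rewrite (A_Estar (Estar_chain j.+1)) chain_raise /= hx. Qed.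

Lemma chain_eq0 j : (D < j + m)%N -> chain j = 0.
Proof. by move=> lt; rewrite /chain Estar_eq0. Qed.

Lemma mem_chain_span j : chain j \in chain_span.
Proof.
have [le|lt] := leqP j D; last by rewrite chain_eq0 ?mem0v // ltn_addr.
have ltj : (j < D.+1)%N by [].
exact: subvP (sumv_sup (Ordinal ltj) isT (subvv _)) _ (memv_line _).
Qed.

Lemma chain_span_ind (P : V -> Prop) : P 0 -> (forall u w, P u -> P w -> P (u + w)) ->
  (forall c u, P u -> P (c *: u)) -> (forall j, P (chain j)) ->
  forall u, u \in chain_span -> P u.
Proof.
move=> P0 PD PZ Pc u /memv_sumP[us usE ->]; elim/big_ind: _ => // j _.
by have /vlineP[k ->] := usE j isT; apply: PZ.
Qed.

Lemma chain_span_module : T_module e x chain_span.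
Proof.
apply: T_module_gen => [u|i u].
  elim/chain_span_ind => [|u1 u2|c u1|j]; first by rewrite mulmx0 mem0v.
  - by rewrite mulmxDr; exact: memvD.
  - by rewrite -scalemxAr; exact: memvZ.
  - case: j => [|j]; first by rewrite A_chain0 memvZ ?mem_chain_span.
    by rewrite A_chainS memvD // memvZ ?mem_chain_span.
elim/chain_span_ind => [|u1 u2|c u1|j]; first by rewrite mulmx0 mem0v.
- by rewrite mulmxDr; exact: memvD.
- by rewrite -scalemxAr; exact: memvZ.
- rewrite -Estar_chain Estar_mulmx; case: eqP => [->|_]; last exact: mem0v.
  by rewrite Estar_chain mem_chain_span.
Qed.

Lemma Estar_chain_span j u : u \in chain_span -> exists c, E (j + m) *m u = c *: chain j.
Proof.
elim/chain_span_ind => [|u1 u2 [c1 h1] [c2 h2]|c u1 [c1 h]|i].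
- by exists 0; rewrite mulmx0 scale0r.
- by exists (c1 + c2); rewrite mulmxDr h1 h2 scalerDl.
- by exists (c * c1); rewrite -scalemxAr h scalerA.
rewrite -Estar_chain Estar_mulmx eqn_add2r; case: eqP => [->|_].
  by exists 1; rewrite scale1r Estar_chain.
by exists 0; rewrite scale0r.
Qed.

Lemma irreducible_chain_span W : T_irreducible e x W -> v \in W -> v != 0 ->
  W = chain_span.
Proof.
case=> TW _ irr vW v0; case: (irr chain_span) => [||N0|//]; first exact: chain_span_module.
  apply/subvP => u; elim/chain_span_ind => [|u1 u2|c u1|j]; first exact: mem0v.
  - exact: memvD.
  - exact: memvZ.
  - exact: chain_mem.
by have := mem_chain_span 0; rewrite chain0 N0 memv0 (negPf v0).
Qed.

End Chain.

End Levels.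

(** * Modules of endpoint 0 and 1, isomorphisms of chains *)

Section Endpoints.
Variables (C : numClosedFieldType) (X : finType) (e : rel X) (x : X).
Variable (p : nat -> nat -> nat -> nat).
Hypotheses (he : simple_graph e) (hbip : bipartite e).
Hypothesis hdr : distance_regular e p.
Local Notation V := 'cV[C]_#|X|.
Local Notation MX := 'M[C]_#|X|.
Local Notation T := (@terwilliger C X e x).
Local Notation E := (Estar C e x).
Local Notation A := (dist_mx C e).
Local Notation D := (diameter e).
Local Notation chain := (chain e x).
Local Notation chain_span := (chain_span e x).
Implicit Types (u v w : V) (U W M N : {vspace V}) (B : MX).

Lemma T_irreducible_vector W : T_irreducible e x W ->
  exists v, [/\ v \in W, E (endpoint e x W) *m v = v & v != 0].
Proof.
move=> hW; have [TW _ _] := hW; have [_ E0 _] := endpointP hW.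
have := memv_pick (Estar_img e x (endpoint e x W) W).
move=> /(Estar_imgP _ _ TW)[vW vE]; exists (vpick (Estar_img e x (endpoint e x W) W)).
by rewrite vpick0.
Qed.

Lemma inter_c_neq0 j : (j < D)%N -> (p j.+1 j 1)%:R != 0 :> C.
Proof. by move=> lt; rewrite pnatr_eq0 -lt0n (inter_c_gt0 x he hdr). Qed.

Lemma chain_endpoint0 v j : E 0 *m v = v ->
  E (j + 0) *m (A 1 *m chain 0 v j.+1) = (p j j.+1 1)%:R *: chain 0 v j.
Proof.
move=> vE; rewrite !chainE !addn0; case: j => [|j].
  rewrite (level0_recr x he hbip hdr) (Estar_dist_eq0 he hbip hdr (j := 2) vE) //.
  by rewrite scaler0 addr0.
have := level_recr x he hbip hdr j j.+1 v.
rewrite (Estar_dist_eq0 he hbip hdr (i := j) vE); last by lia.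
rewrite (Estar_dist_eq0 he hbip hdr (i := j.+1) (j := j.+3) vE); last by lia.
by rewrite !mulmx0 !addr0 scaler0 addr0.
Qed.

Lemma chain_endpoint1 v j : E 1 *m v = v -> E 0 *m (A 1 *m v) = 0 ->
  E (j + 1) *m (A 1 *m chain 1 v j.+1) = (p j.+2 j.+3 1)%:R *: chain 1 v j.
Proof.
move=> vE low; have v0 := sum_coord_eq0 hdr vE low.
have S i : E i.+1 *m (A i.+2 *m v) = - chain 1 v i.
  have := level_sum he hbip hdr i vE v0; rewrite !big_ord_recr big_ord0 /= add0r.
  rewrite addn0 addn2 (addn1 i) => /eqP; rewrite addr_eq0 => /eqP.
  by rewrite chainE (addn1 i) => ->; rewrite opprK.
have := level_recr x he hbip hdr j j.+2 v.
rewrite (Estar_dist_eq0 he hbip hdr (i := j) vE); last by lia.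
rewrite (Estar_dist_eq0 he hbip hdr (i := j.+1) (j := j.+4) vE); last by lia.
rewrite !mulmx0 !addr0 scaler0 addr0 !S !mulmxN scalerN => /oppr_inj.
by rewrite (addn1 j).
Qed.

Hypothesis D_ge4 : (4 <= D)%N.
Let D_gt0 : (0 < D)%N. Proof. lia. Qed.

Lemma chain_next_eq0 m v j : E m *m v = v -> chain m v j = 0 -> chain m v j.+1 = 0.
Proof.
move=> vE c0; have [lt|le] := ltnP j D; last by rewrite chain_eq0 //; lia.
have := chain_raise he hbip hdr vE D_gt0 j; rewrite c0 !mulmx0 => /esym/eqP.
by rewrite scaler_eq0 (negPf (inter_c_neq0 lt)) => /eqP.
Qed.

Lemma Estar2_low_endpoint W w : T_irreducible e x W -> (endpoint e x W <= 1)%N ->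
  w \in W -> exists w1, [/\ w1 \in W, E 1 *m w1 = w1 & E 2 *m w = E 2 *m (A 1 *m w1)].
Proof.
move=> hW le1 wW; have [TW _ _] := hW; have [v [vW vE v0]] := T_irreducible_vector hW.
have [_ _ low] := endpointP hW.
case: (endpoint e x W) le1 vE low => [_|[_|//]] vE low.
  have hx := fun j => chain_endpoint0 j vE.
  have low0 i : i.+1 = 0%N -> E i *m (A 1 *m v) = 0 by [].
  have WE := irreducible_chain_span he hbip hdr vE D_gt0 low0 hx hW vW v0.
  move: (wW); rewrite WE => /(Estar_chain_span 2)[c cE]; rewrite addn0 in cE.
  rewrite -WE.
  exists ((c / (p 2 1 1)%:R) *: chain 0 v 1); split.
  - by rewrite memvZ // (chain_mem he hbip hdr).
  - by rewrite -scalemxAr (Estar_chain e x 0 v 1).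
  have := chain_raise he hbip hdr vE D_gt0 1; rewrite addn0 => h.
  by rewrite cE -!scalemxAr h scalerA divfK //; apply: inter_c_neq0; lia.
have v1 : E 0 *m (A 1 *m v) = 0 by apply: low => //; apply: TW => //; apply: terw_A.
have hx := fun j => chain_endpoint1 j vE v1.
have low1 i : i.+1 = 1%N -> E i *m (A 1 *m v) = 0 by case=> ->.
have WE := irreducible_chain_span he hbip hdr vE D_gt0 low1 hx hW vW v0.
move: (wW); rewrite WE => /(Estar_chain_span 1)[c cE]; rewrite addn1 in cE.
rewrite -WE; exists (c *: v); split.
- by rewrite memvZ.
- by rewrite -scalemxAr vE.
have := chain_raise he hbip hdr vE D_gt0 0; rewrite (chain0 hdr vE).
by rewrite (inter101 x he hdr) // scale1r add0n => h; rewrite cE -!scalemxAr h.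
Qed.

Lemma herm_Estar_neq i j u w : E i *m u = u -> E j *m w = w -> i != j -> herm u w = 0.
Proof.
move=> uE wE ij; rewrite -uE herm_mulmx adjmx_Estar -wE Estar_mulmx (negPf ij).
exact: herm0r.
Qed.

Section ChainIso.
Variables (m : nat) (xs : nat -> C).

Definition has_chain v := [/\ E m *m v = v,
  forall i, i.+1 = m -> E i *m (A 1 *m v) = 0 &
  forall j, E (j + m) *m (A 1 *m chain m v j.+1) = xs j *: chain m v j].

Lemma chain_norm v j : has_chain v ->
  (p j.+1 j 1)%:R * herm (chain m v j.+1) (chain m v j.+1) =
  (xs j)^* * herm (chain m v j) (chain m v j).
Proof.
case=> vE low hx; rewrite -hermZl -(chain_raise he hbip hdr vE D_gt0) -hermZr -hx.
rewrite (herm_mulmx (E _)) (herm_mulmx (A 1)) adjmx_Estar (adjmx_dist C he hdr).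
rewrite -addSn Estar_chain; apply/esym; rewrite herm_conj (herm_mulmx (E _)) adjmx_Estar.
by rewrite Estar_chain -herm_conj.
Qed.

(* chain_norm makes the vanishing of a chain depend on the scalars xs alone. *)
Lemma chain_eq0_transfer v v' j : has_chain v -> has_chain v' -> v' != 0 ->
  chain m v' j = 0 -> chain m v j = 0.
Proof.
move=> hv hv' v'0; have [vE _ _] := hv; have [vE' _ _] := hv'.
elim: j => [|j IH] c0; first by rewrite (chain0 hdr vE') in c0; rewrite c0 eqxx in v'0.
have [|lt] := leqP D (j + m); first by move=> le; rewrite chain_eq0 //; lia.
have ltj : (j < D)%N by lia.
have := chain_norm j hv'; rewrite c0 herm0l mulr0 => /esym/eqP.
rewrite mulf_eq0 herm_eq0 => /orP[|/eqP/IH/chain_next_eq0]; last by apply.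
move=> /eqP x0; have := chain_norm j hv; rewrite x0 mul0r => /eqP.
by rewrite mulf_eq0 (negPf (inter_c_neq0 ltj)) herm_eq0 => /eqP.
Qed.

Lemma chain_iso W W' v v' : T_irreducible e x W -> T_irreducible e x W' ->
  v \in W -> v' \in W' -> v != 0 -> v' != 0 -> has_chain v -> has_chain v' ->
  T_iso e x W W'.
Proof.
move=> hW hW' vW v'W' v0 v'0 hv hv'.
have [vE low hx] := hv; have [vE' low' hx'] := hv'.
have WE := irreducible_chain_span he hbip hdr vE D_gt0 low hx hW vW v0.
have WE' := irreducible_chain_span he hbip hdr vE' D_gt0 low' hx' hW' v'W' v'0.
have [TW W0 irr] := hW.
pose M : MX := \sum_(j < D.+1) (herm (chain m v j) (chain m v j))^-1 *:
  (chain m v' j *m map_mx Num.conj (chain m v j)^T).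
(* Where a vector of the chain vanishes the weight is 0^-1 = 0, and the image vanishes as well. *)
have ME u : M *m u = \sum_(j < D.+1) ((herm (chain m v j) (chain m v j))^-1 *
    herm u (chain m v j)) *: chain m v' j.
  rewrite mulmx_suml; apply: eq_bigr => j _; rewrite -scalemxAl -mulmxA.
  rewrite [map_mx _ _ *m u]mx11_scalar mul_mx_scalar scalerA; congr (_ * _ *: _).
  by rewrite mxE; apply: eq_bigr => a _; rewrite !mxE mulrC.
pose f : 'End(V) := linfun (mulmx M : V -> V).
have fc j : f (chain m v j) = chain m v' j.
  rewrite lfunE /= ME; have [le|lt] := leqP j D; last first.
    have lt' : (D < j + m)%N by lia.
    have z u : chain m u j = 0 by rewrite chain_eq0.
    rewrite !z.
    by apply: big1 => i _; rewrite herm0l mulr0 scale0r.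
  have ltj : (j < D.+1)%N by [].
  rewrite (bigD1 (Ordinal ltj)) //= big1 ?addr0 => [|i].
    have [c0|c0] := eqVneq (chain m v j) 0.
      by rewrite c0 herm0l mulr0 scale0r (chain_eq0_transfer hv' hv).
    by rewrite mulVf ?scale1r // herm_eq0.
  rewrite -val_eqE /= => ij.
  rewrite (herm_Estar_neq (Estar_chain e x m v j) (Estar_chain e x m v i)).
    by rewrite mulr0 scale0r.
  by rewrite eqn_add2r eq_sym.
have fB B w : T B -> w \in W -> f (B *m w) = B *m f w.
  move=> TB; elim: TB w => [|i le||B1 B2 _ T1 _ T2|a B1 _ T1|B1 B2 T1' T1 T2' T2] w wW.
  - move: wW; rewrite WE; elim/chain_span_ind => [|u1 u2 h1 h2|c u1 h1|j].
    + by rewrite !(mulmx0, linear0).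
    + by rewrite !(mulmxDr, linearD) /= h1 h2.
    + by rewrite -scalemxAr !linearZ /= h1.
    case: j => [|j].
      by rewrite fc !(A_chain0 he hbip hdr) // linearZ /= fc.
    rewrite fc (A_chainS he hbip hdr vE D_gt0 hx) (A_chainS he hbip hdr vE' D_gt0 hx').
    by rewrite linearD !linearZ /= !fc.
  - move: wW; rewrite WE; elim/chain_span_ind => [|u1 u2 h1 h2|c u1 h1|j].
    + by rewrite !(mulmx0, linear0).
    + by rewrite !(mulmxDr, linearD) /= h1 h2.
    + by rewrite -scalemxAr !linearZ /= h1.
    rewrite fc -[chain m v j]Estar_chain -[chain m v' j]Estar_chain !Estar_mulmx.
    by case: eqP => [->|_] /=; [exact: fc | exact: linear0].
  - by rewrite !mul1mx.
  - by rewrite !mulmxDl linearD /= T1 ?T2.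
  - by rewrite -!scalemxAl linearZ /= T1.
  - by rewrite -!mulmxA T1 ?T2 //; apply: TW.
exists f; split=> //.
  by rewrite WE WE' limg_sum; apply: eq_bigr => j _; rewrite limg_line fc.
have Tk : T_module e x (W :&: lker f)%VS.
  move=> B w TB /memv_capP[wW]; rewrite memv_ker => /eqP fw.
  by rewrite memv_cap TW // memv_ker fB // fw mulmx0 eqxx.
case: (irr _ Tk (capvSl _ _)) => // kW; case/eqP: v'0.
have : v \in (W :&: lker f)%VS by rewrite kW.
by rewrite memv_cap memv_ker -(chain0 hdr vE) fc (chain0 hdr vE') => /andP[_ /eqP].
Qed.

End ChainIso.

End Endpoints.

(** * Thin modules of endpoint 2 *)

Section ThinEndpoint2.
Variables (C : numClosedFieldType) (X : finType) (e : rel X) (x : X).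
Variable (p : nat -> nat -> nat -> nat).
Hypotheses (he : simple_graph e) (hbip : bipartite e).
Hypothesis hdr : distance_regular e p.
Hypothesis D_ge4 : (4 <= diameter e)%N.
Local Notation V := 'cV[C]_#|X|.
Local Notation MX := 'M[C]_#|X|.
Local Notation E := (Estar C e x).
Local Notation A := (dist_mx C e).
Local Notation D := (diameter e).
Local Notation chain := (chain e x).
Local Notation chain_span := (chain_span e x).
Implicit Types (u v w : V) (U W M N : {vspace V}) (B : MX).

Let D_gt0 : (0 < D)%N. Proof. lia. Qed.

(* With P_j = E*_(j+2) A_j w, Q_j = E*_(j+2) A_(j+2) w and S_j = E*_(j+2) A_(j+4) w one has
   P_j + Q_j + S_j = 0. If Q_j = q_j P_j, the components at level j + 2 of A A_(j+1) w and of
   A A_(j+5) w give that lowering P_(j+1) yields x_j P_j, where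
     x_j = b_j + c_(j+2) q_j - c_j q_(j-1),    x_j (1 + q_(j+1)) = b_(j+4) (1 + q_j);
   lower_coef is x_j, and local_ratio eta j is (q_(j-1), q_j) with q_0 = eta. *)
Definition lower_coef (j : nat) (q : C * C) : C :=
  (p j j.+1 1)%:R + (p j.+2 j.+1 1)%:R * q.2 - (p j j.-1 1)%:R * q.1.

Fixpoint local_ratio (eta : C) (j : nat) : C * C :=
  if j is j'.+1 then
    let q := local_ratio eta j' in
    (q.2, (p j'.+4 j'.+1.+4 1)%:R * (1 + q.2) / lower_coef j' q - 1)
  else (0, eta).

Lemma dim_le1_colinear W u v : (\dim W <= 1)%N -> u \in W -> v \in W -> u != 0 ->
  exists c, v = c *: u.
Proof.
move=> d1 uW vW u0; apply/vlineP.
have uv : (<[u]> <= W)%VS by rewrite -memvE.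
suff <- : W = <[u]>%VS by [].
by apply/esym/eqP; rewrite eqEdim uv dim_vline u0.
Qed.

Lemma thin2_has_chain eta W w : thin2 e x eta W -> w \in Estar_img e x 2 W -> w != 0 ->
  has_chain e x 2 (fun j => lower_coef j (local_ratio eta j)) w.
Proof.
case=> hW tW eW [w' [w'E w'0 lw']] wE2 w0; have [TW _ _] := hW.
have lw : local_mx C e x *m w = eta *: w.
  have [c ->] := dim_le1_colinear (tW 2) w'E wE2 w'0.
  by rewrite -scalemxAr lw' !scalerA mulrC.
have [wW wE] := Estar_imgP _ _ TW wE2.
have [_ _ low] := endpointP hW; rewrite eW in low.
have TA j u : u \in W -> A j *m u \in W by apply: TW; exact: terw_dist he hbip hdr j.
have low1 : E 1 *m (A 1 *m w) = 0 by apply: low => //; exact: TA.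
have low2 i : i.+1 = 2 -> E i *m (A 1 *m w) = 0 by case=> ->.
have sumw : \sum_a w a 0 = 0.
  by apply: (sum_coord_eq0 hdr wE); apply: low => //; exact: TA.
have raise j : E j.+3 *m (A 1 *m chain 2 w j) = (p j.+1 j 1)%:R *: chain 2 w j.+1.
  by have := chain_raise he hbip hdr wE D_gt0 j; rewrite addn2.
have memc j : chain 2 w j \in W by exact: chain_mem he hbip hdr _ _ _ _ TW wW.
have /choice[xs hxs] : forall j, exists c, E (j + 2) *m (A 1 *m chain 2 w j.+1) = c *: chain 2 w j.
  move=> j; have [c0|c0] := eqVneq (chain 2 w j) 0.
    by exists 0; rewrite (chain_next_eq0 he hbip hdr D_ge4 wE c0) !mulmx0 scale0r.
  apply: (dim_le1_colinear (tW (j + 2)%N)) => //.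
    by rewrite -Estar_chain mem_Estar_img.
  by rewrite mem_Estar_img // TA.
have WE := irreducible_chain_span he hbip hdr wE D_gt0 low2 hxs hW wW w0.
pose Q j := E j.+2 *m (A j.+2 *m w); pose S j := E j.+2 *m (A j.+4 *m w).
have chainE j : chain 2 w j = E j.+2 *m (A j *m w) by rewrite chainE addn2.
have sumPQS j : S j = - (chain 2 w j + Q j).
  have := level_sum he hbip hdr j wE sumw; rewrite !big_ord_recr big_ord0 /= add0r.
  rewrite addn0 addn2 (addnS j 3) (addn3 j) => /eqP; rewrite addrC addr_eq0 => /eqP.
  by rewrite /S /Q chainE => ->.
have Qline j : exists c, Q j = c *: chain 2 w j.
  have : A j.+2 *m w \in chain_span 2 w by rewrite -WE TA.
  by case/(Estar_chain_span j)=> c; rewrite addn2; exists c.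
have lower j q : Q j = q.2 *: chain 2 w j ->
    E j.+2 *m (A 1 *m (E j.+1 *m (A j.+1 *m w))) = ((p j j.-1 1)%:R * q.1) *: chain 2 w j ->
    E j.+2 *m (A 1 *m chain 2 w j.+1) = lower_coef j q *: chain 2 w j.
  move=> Qj Rj; have := level_recr x he hbip hdr j.+1 j w.
  rewrite Rj -!chainE -/(Q j) Qj => /(canRL (addrK _)) ->.
  by rewrite !scalerA -scalerDl -scalerBl.
have main j : Q j = (local_ratio eta j).2 *: chain 2 w j /\
    E j.+2 *m (A 1 *m (E j.+1 *m (A j.+1 *m w))) =
      ((p j j.-1 1)%:R * (local_ratio eta j).1) *: chain 2 w j.
  elim: j => [|j [Qj Rj]].
    rewrite mulr0 scale0r low1 !mulmx0; split=> //.
    by rewrite (chain0 hdr wE) -lw /local_mx -!mulmxA wE.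
  split; last by rewrite -/(Q j) Qj -!scalemxAr raise scalerA mulrC.
  have [c1|c1] := eqVneq (chain 2 w j.+1) 0.
    by have [c ->] := Qline j.+1; rewrite c1 !scaler0.
  have c0 : chain 2 w j != 0.
    by apply: contraNneq c1 => /(chain_next_eq0 he hbip hdr D_ge4 wE) ->.
  have lj := lower j _ Qj Rj.
  set xj := lower_coef j _ in lj.
  have x0 : xj != 0.
    apply: contraNneq c1 => x0.
    have hx i : E (i + 2) *m (A 1 *m chain 2 w i.+1) = xs i *: chain 2 w i := hxs i.
    have ltj : (j < D)%N.
      rewrite ltnNge; apply: contra c0 => le; rewrite chain_eq0 //; lia.
    have hch : has_chain e x 2 xs w by split.
    have := chain_norm he hbip hdr D_ge4 j hch.
    have -> : xs j = 0.
      have := hxs j; rewrite addn2 lj x0 scale0r => /esym/eqP.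
      by rewrite scaler_eq0 (negPf c0) orbF => /eqP.
    rewrite rmorph0 mul0r => /eqP; rewrite mulf_eq0 herm_eq0.
    by rewrite (negPf (inter_c_neq0 C x he hdr ltj)).
  have [c Qc] := Qline j.+1.
  have := level_recr x he hbip hdr j.+1 j.+4 w.
  rewrite (Estar_dist_eq0 he hbip hdr (i := j.+1) wE); last by lia.
  rewrite (Estar_dist_eq0 he hbip hdr (i := j.+2) (j := j.+4.+2) wE); last by lia.
  rewrite !mulmx0 scaler0 !addr0 -/(S j.+1) -/(S j) !sumPQS Qc Qj.
  rewrite -[X in X + c *: _]scale1r -[X in - (X + _ *: chain 2 w j)]scale1r -!scalerDl.
  rewrite !mulmxN -!scalemxAr lj scalerN => /oppr_inj/eqP; rewrite !scalerA -subr_eq0 -scalerBl.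
  rewrite scaler_eq0 (negPf c0) orbF subr_eq0 => /eqP h.
  by rewrite /= -/xj -h mulfK // addrAC subrr add0r.
split=> // j; rewrite addn2; have [Qj Rj] := main j; exact: lower.
Qed.

Lemma thin2_iso eta W W' : thin2 e x eta W -> thin2 e x eta W' -> T_iso e x W W'.
Proof.
move=> hW hW'; have [irr _ _ [w [wE w0 _]]] := hW; have [irr' _ _ [w' [wE' w'0 _]]] := hW'.
have [TW _ _] := irr; have [TW' _ _] := irr'.
have [wW _] := Estar_imgP _ _ TW wE; have [wW' _] := Estar_imgP _ _ TW' wE'.
exact: (chain_iso he hbip hdr D_ge4 irr irr' wW wW' w0 w'0
  (thin2_has_chain hW wE w0) (thin2_has_chain hW' wE' w'0)).
Qed.

End ThinEndpoint2.

(** * The spaces U_eta and H_eta *)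

Section Multiplicity.
Variables (C : numClosedFieldType) (X : finType) (e : rel X) (x : X).
Variable (p : nat -> nat -> nat -> nat).
Hypotheses (he : simple_graph e) (hbip : bipartite e).
Hypothesis hdr : distance_regular e p.
Hypothesis D_ge4 : (4 <= diameter e)%N.
Local Notation V := 'cV[C]_#|X|.
Local Notation MX := 'M[C]_#|X|.
Local Notation E := (Estar C e x).
Local Notation A := (dist_mx C e).
Implicit Types (u v w : V) (U W M N : {vspace V}) (B : MX).

Lemma herm_low_endpoint u W w : E 2 *m u = u -> E 1 *m (A 1 *m u) = 0 ->
  T_irreducible e x W -> (endpoint e x W <= 1)%N -> w \in W -> herm u (E 2 *m w) = 0.
Proof.
move=> uE Lu hW le1 wW.
have [w1 [_ w1E ->]] := Estar2_low_endpoint he hbip hdr D_ge4 hW le1 wW.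
rewrite -(adjmx_Estar C e x 2) -herm_mulmx uE -(adjmx_dist C he hdr 1) -herm_mulmx.
by rewrite -w1E -(adjmx_Estar C e x 1) -herm_mulmx Lu herm0l.
Qed.

Lemma span_of0 (P : {vspace V} -> Prop) : span_of P 0.
Proof. by exists [::]; split=> //; exact: mem0v. Qed.

Lemma span_of_mem (P : {vspace V} -> Prop) W w : P W -> w \in W -> span_of P w.
Proof.
move=> PW wW; exists [:: W]; split; last by rewrite big_seq1.
by move=> W'; rewrite inE => /eqP->.
Qed.

Lemma span_of_ind (P : {vspace V} -> Prop) (Q : V -> Prop) :
  Q 0 -> (forall u v, Q u -> Q v -> Q (u + v)) ->
  (forall W w, P W -> w \in W -> Q w) -> forall v, span_of P v -> Q v.
Proof.
move=> Q0 QD QP v [s [hs]]; elim: s v hs => [|W s IH] v hs.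
  by rewrite big_nil memv0 => /eqP->.
rewrite big_cons => /memv_addP[w wW [u us ->]]; apply: QD.
  by apply: QP wW; apply: hs; rewrite inE eqxx.
by apply: IH us => W' W's; apply: hs; rewrite inE W's orbT.
Qed.

Lemma UP u : U e x u <-> E 2 *m u = u /\ E 1 *m (A 1 *m u) = 0.
Proof.
split=> [[[v uv] h]|[uE Lu]]; last first.
  split; first by exists u.
  move=> v y hv hy; rewrite hermDr.
  have -> : herm u (E 2 *m v) = 0.
    elim/span_of_ind: _ / hv => [|v1 v2 h1 h2|W w [hW eW] wW].
    - by rewrite mulmx0 herm0r.
    - by rewrite mulmxDr hermDr h1 h2 addr0.
    - by apply: (herm_low_endpoint uE Lu hW); rewrite ?eW.
  rewrite add0r; elim/span_of_ind: _ / hy => [|v1 v2 h1 h2|W w [hW eW] wW].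
  - by rewrite mulmx0 herm0r.
  - by rewrite mulmxDr hermDr h1 h2 addr0.
  - by apply: (herm_low_endpoint uE Lu hW); rewrite ?eW.
have uE : E 2 *m u = u by rewrite uv EstarK.
split=> //; apply/eqP; rewrite -herm_eq0; apply/eqP.
set w := E 1 *m (A 1 *m u).
have wE : E 1 *m w = w by exact: EstarK.
have low W w1 : T_irreducible e x W -> w1 \in W -> herm u (E 2 *m (A 1 *m (E 1 *m w1))) = 0.
  move=> hW w1W; have [TW _ _] := hW; have [_ _ lo] := endpointP hW.
  have aW : A 1 *m (E 1 *m w1) \in W.
    by apply: (TW); [exact: terw_A | apply: (TW) => //; exact: terw_EstarT].
  case eW : (endpoint e x W) lo => [|[|n]] lo; last by rewrite (lo 1%N w1) // !mulmx0 herm0r.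
    have := h (A 1 *m (E 1 *m w1)) 0; rewrite mulmx0 addr0; apply; last exact: span_of0.
    exact: span_of_mem aW.
  have := h 0 (A 1 *m (E 1 *m w1)); rewrite mulmx0 add0r; apply; first exact: span_of0.
  exact: span_of_mem aW.
have -> : herm w w = herm u (E 2 *m (A 1 *m w)).
  rewrite {1}/w herm_mulmx adjmx_Estar wE -{1}uE herm_mulmx (adjmx_dist C he hdr).
  by rewrite herm_mulmx adjmx_Estar.
have Tf : T_module e x (fullv : {vspace V}) by move=> *; exact: memvf.
have [s [irr us _ sums]] := exists_orth_decomposition he hdr Tf.
have : w \in (\sum_(W <- s) W)%VS by rewrite sums memvf.
case/(mem_sumsP (F := id))=> f fs /(_ us) wf; rewrite -wE wf !mulmx_sumr.
rewrite herm_conj herm_suml big1_seq ?rmorph0 // => W /andP[_ Ws].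
by rewrite herm_conj (low W) ?rmorph0 //; [exact: irr | exact: fs].
Qed.

Definition kermx_v (B : MX) : {vspace V} := lker (linfun (mulmx B : V -> V)).

Lemma mem_kermx_v B v : (v \in kermx_v B) = (B *m v == 0).
Proof. by rewrite memv_ker lfunE. Qed.

Definition level i : {vspace V} := kermx_v (E i - 1%:M).
Definition local_eigenspace eta : {vspace V} := kermx_v (local_mx C e x - eta%:M).
Definition U_space eta : {vspace V} :=
  (local_eigenspace eta :&: level 2 :&: kermx_v (E 1 *m A 1))%VS.

Lemma mem_level i v : (v \in level i) = (E i *m v == v).
Proof. by rewrite mem_kermx_v mulmxBl mul1mx subr_eq0. Qed.

Lemma mem_local_eigenspace eta v :
  (v \in local_eigenspace eta) = (local_mx C e x *m v == eta *: v).
Proof. by rewrite mem_kermx_v mulmxBl mul_scalar_mx subr_eq0. Qed.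

Lemma mem_U_space eta u : u \in U_space eta <-> U_eta e x eta u.
Proof.
rewrite !memv_cap mem_local_eigenspace mem_level mem_kermx_v -mulmxA.
split=> [/andP[/andP[/eqP lu /eqP uE] /eqP Lu]|[/UP[-> ->] ->]]; last by rewrite !eqxx.
by split=> //; apply/UP.
Qed.

Lemma thin2_U_space eta W w : thin2 e x eta W -> w \in W -> E 2 *m w \in U_space eta.
Proof.
case=> hW tW eW [w' [w'E w'0 lw']] wW; have [TW _ _] := hW; have [_ _ low] := endpointP hW.
rewrite !memv_cap mem_local_eigenspace mem_level mem_kermx_v -mulmxA EstarK eqxx andbT.
apply/andP; split; last first.
  apply/eqP; apply: low; first by rewrite eW.
  by apply: (TW); [exact: terw_A | apply: (TW) => //; exact: terw_EstarT].
have [c ->] := dim_le1_colinear (tW 2) w'E (mem_Estar_img e x 2 wW) w'0.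
by rewrite -scalemxAr lw' !scalerA mulrC.
Qed.

Lemma Estar_H_eta_sub eta v : H_eta e x eta v -> E 2 *m v \in U_space eta.
Proof.
elim/span_of_ind=> [|u w hu hw|W w hW wW]; first by rewrite mulmx0 mem0v.
  by rewrite mulmxDr memvD.
exact: thin2_U_space hW wW.
Qed.

Lemma thin2_dim eta W : thin2 e x eta W -> \dim (Estar_img e x 2 W) = 1%N.
Proof.
case=> _ tW _ [w [wE w0 _]]; apply/eqP; rewrite eqn_leq tW lt0n dimv_eq0.
by apply: contraNneq w0 => W0; rewrite -memv0 -W0.
Qed.

Lemma exists_T_decomposition : exists s, orth_decomposition (C := C) e x s.
Proof.
have Tf : T_module e x (fullv : {vspace V}) by move=> *; exact: memvf.
have [s [irr us orth sums]] := exists_orth_decomposition he hdr Tf.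
exists s; split=> // W W' Ws W's ne w w' wW wW'.
by have /subvP/(_ w wW)/perpP := orth _ _ Ws W's ne; apply.
Qed.

Definition thin2_space eta (s : seq {vspace V}) : {vspace V} :=
  (\sum_(W <- [seq W <- s | `[< thin2 e x eta W >]]) Estar_img e x 2 W)%VS.

Lemma mem_thin2_space eta s v : orth_decomposition e x s ->
  v \in thin2_space eta s <-> exists2 h, H_eta e x eta h & E 2 *m h = v.
Proof.
case=> irr us orth sums; split=> [|[h hh <-]].
  case/mem_sumsP=> f fs ->; last exact: filter_uniq.
  rewrite big_seq; elim/big_rec: _ => [|W w Ws [h hh <-]].
    by exists 0; rewrite ?mulmx0 //; exact: span_of0.
  have /memv_imgP[u uW fE] := fs W Ws; rewrite lfunE /= in fE.
  move: Ws; rewrite mem_filter => /andP[/asboolP hW _].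
  exists (u + h); last by rewrite mulmxDr fE.
  case: hh => s' [hs' hs'h]; exists (W :: s'); split.
    by move=> W'; rewrite inE => /orP[/eqP->//|]; exact: hs'.
  by rewrite big_cons memv_add.
elim/span_of_ind: _ / hh => [|u w hu hw|W w hW wW]; first by rewrite mulmx0 mem0v.
  by rewrite mulmxDr memvD.
have : w \in (\sum_(W <- s) W)%VS by rewrite sums memvf.
case/(mem_sumsP (F := id))=> f fs /(_ us) wf; rewrite wf mulmx_sumr big_seq.
apply: memv_suml => W' W's; have [ht|ht] := boolP `[< thin2 e x eta W' >].
  apply: subvP (mem_Estar_img e x 2 (fs _ W's)).
  by apply: (sumv_seq_sup (Estar_img e x 2)); rewrite mem_filter ht.
suff -> : f W' = 0 by rewrite mulmx0 mem0v.
apply/eqP; rewrite -herm_eq0.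
have <- : herm w (f W') = herm (f W') (f W').
  rewrite wf herm_suml (bigD1_seq W') //= big1_seq ?addr0 // => W'' /andP[ne W''s].
  by apply: (orth W'' W') => //; exact: fs.
have [irrW _ _ _] := hW.
case: (schur he hdr irrW (irr _ W's)) => [/subvP/(_ _ wW)/perpP->//|iso].
  exact: fs.
by case/asboolP: ht; exact: T_iso_thin2 he hbip hdr _ _ _ hW (irr _ W's) iso.
Qed.

Lemma dim_thin2_space eta s : orth_decomposition e x s ->
  \dim (thin2_space eta s) = count (fun W => `[< thin2 e x eta W >]) s.
Proof.
case=> irr us orth sums; rewrite dim_orth_sum ?filter_uniq //.
  rewrite big_seq -size_filter -sum1_size [RHS]big_seq; apply: eq_bigr => W.
  by rewrite mem_filter => /andP[/asboolP/thin2_dim].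
move=> W W'; rewrite !mem_filter => /andP[_ Ws] /andP[_ W's] ne.
have [TW _ _] := irr _ Ws; have [TW' _ _] := irr _ W's.
apply/subvP => w /(Estar_imgP _ _ TW)[wW _]; apply/perpP => w' /(Estar_imgP _ _ TW')[w'W _].
exact: orth ne _ _ wW w'W.
Qed.

Lemma mu_etaE eta s : orth_decomposition e x s ->
  mu_eta e x eta = \dim (thin2_space eta s).
Proof.
move=> hs.
have countE s' W : orth_decomposition e x s' -> thin2 e x eta W ->
    count (fun W' => `[< T_iso e x W W' >]) s' = \dim (thin2_space eta s).
  move=> hs' hW; have [irr _ _ _] := hs'.
  have -> : thin2_space eta s = thin2_space eta s'.
    apply/vspaceP => v; apply/idP/idP.
      by move/(mem_thin2_space _ _ hs)/(mem_thin2_space _ _ hs').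
    by move/(mem_thin2_space _ _ hs')/(mem_thin2_space _ _ hs).
  rewrite dim_thin2_space //; apply: eq_in_count => W' /irr irrW'.
  apply/asboolP/asboolP => h; first exact: T_iso_thin2 he hbip hdr _ _ _ hW irrW' h.
  exact: thin2_iso he hbip hdr D_ge4 _ _ _ hW h.
case: (pselect (exists W : {vspace V}, thin2 e x eta W)) => [[W hW]|no].
  apply: xget_unique; first by exists s, W; split=> //; rewrite (countE s W).
  by move=> m [s' [W' [hs' hW' ->]]]; exact: countE.
rewrite /mu_eta xgetPN; last by move=> m [s' [W [_ hW _]]]; case: no; exists W.
rewrite dim_thin2_space // (eq_count (a2 := pred0)) ?count_pred0 // => W.
by apply/asboolP => hW; case: no; exists W.
Qed.

End Multiplicity.

(** * Eigenspaces of the local matrix *)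

Section LocalEigenspaces.
Variables (C : numClosedFieldType) (X : finType) (e : rel X) (x : X).
Variable (p : nat -> nat -> nat -> nat).
Hypotheses (he : simple_graph e) (hbip : bipartite e).
Hypothesis hdr : distance_regular e p.
Hypothesis D_ge4 : (4 <= diameter e)%N.
Local Notation V := 'cV[C]_#|X|.
Local Notation MX := 'M[C]_#|X|.
Local Notation E := (Estar C e x).
Local Notation A := (dist_mx C e).
Local Notation D := (diameter e).
Local Notation d := (dist e).
Local Notation level := (@level C X e x).
Local Notation local_eigenspace := (@local_eigenspace C X e x).
Local Notation U_space := (@U_space C X e x).
Implicit Types (u v w : V) (U W M N : {vspace V}) (B : MX).
Let hcon : graph_connected e := hdr.1.

Definition sphere_vec i : V := E i *m const_mx 1.
Local Notation s_ := sphere_vec.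

Lemma Estar_sphere i : E i *m s_ i = s_ i.
Proof. exact: EstarK. Qed.

Lemma Estar_dist_sphere i j m : E i *m (A j *m s_ m) = (p i j m)%:R *: s_ i.
Proof.
apply/colP => a; rewrite (Estar_distE _ _ a (Estar_sphere m)) [RHS]mxE Estar_mulE mxE mulr1.
under eq_bigr do rewrite Estar_mulE mxE mulr1 -natrM mulnb -!andbA andbb.
have [xa|_] := eqVneq (d x (enum_val a)) i; last by rewrite mulr0 big1.
rewrite mulr1 (sum_enum_val (fun y : X => ((d (enum_val a) y == j) && (d x y == m))%:R)).
rewrite -natr_sum -xa (dist_sym he hcon x (enum_val a)) -(interE hdr) -sum1_card.
rewrite [in RHS]big_mkcond; congr _%:R; apply: eq_bigr => y _.
by rewrite inE (dist_sym he hcon y x); case: (_ && _).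
Qed.

Lemma herm_sphere i v : E i *m v = v -> herm v (s_ i) = \sum_a v a 0.
Proof.
move=> vE; rewrite /sphere_vec -(adjmx_Estar C e x i) -herm_mulmx vE.
by apply: eq_bigr => a _; rewrite mxE rmorph1 mulr1.
Qed.

Lemma Estar0_dist m v : E m *m v = v -> \sum_a v a 0 = 0 -> E 0 *m (A m *m v) = 0.
Proof.
move=> vE v0; apply/colP => a; rewrite (Estar_distE _ _ a vE) mxE.
have [|xa] := boolP (d x (enum_val a) == 0)%N; last by rewrite big1 // => b _; rewrite mul0r.
rewrite dist_eq0 // => /eqP <-; rewrite -[RHS]v0; apply: eq_bigr => b _.
by rewrite andbb -[in RHS]vE Estar_mulE.
Qed.

Definition raise v : V := E 2 *m (A 1 *m v).
Definition low1 : {vspace V} := (level 1 :&: perp <[s_ 1]>)%VS.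
Definition raised : {vspace V} := (linfun (mulmx (E 2 *m A 1) : V -> V) @: low1)%VS.

Lemma raisedP z : reflect (exists2 v, v \in low1 & z = raise v) (z \in raised).
Proof.
by apply: (iffP memv_imgP) => -[v vl ->]; exists v => //; rewrite lfunE /= /raise mulmxA.
Qed.

Lemma low1P v : v \in low1 ->
  [/\ E 1 *m v = v, \sum_a v a 0 = 0 & E 0 *m (A 1 *m v) = 0].
Proof.
case/memv_capP; rewrite mem_level => /eqP vE /perpP/(_ _ (memv_line _)).
by rewrite herm_sphere // => v0; split=> //; exact: Estar0_dist.
Qed.

Lemma lower_raise v : v \in low1 -> E 1 *m (A 1 *m raise v) = (p 2 3 1)%:R *: v.
Proof.
case/low1P=> vE _ v0; have := chain_endpoint1 he hbip hdr 0 vE v0.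
by rewrite (chain0 hdr vE).
Qed.

Lemma local_raise v : v \in low1 ->
  local_mx C e x *m raise v = ((inter_b p 3)%:R - 1) *: raise v.
Proof.
case/low1P=> vE v0 low; rewrite /local_mx /raise -!mulmxA EstarK.
have aE : E 2 *m (A 1 *m v) = A 1 *m v by rewrite [RHS](A_Estar he hbip hdr vE) low addr0.
rewrite [in LHS]aE.
have -> : A 2 *m (A 1 *m v) = A 1 *m (A 2 *m v).
  by rewrite !mulmxA -{1}(trmx_dist_mx he hdr C 2) -{1}(trmx_dist_mx he hdr C 1) -trmx_mul
     (dist_mx_recr x he hbip hdr) linearD !linearZ /= !(trmx_dist_mx he hdr).
rewrite (mulmxA (A 1)) (dist_mx_recr x he hbip hdr) mulmxDl mulmxDr -!scalemxAl -!scalemxAr.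
have := level_sum he hbip hdr 1 vE v0; rewrite !big_ord_recr big_ord0 /= add0r addn0.
rewrite addrC => /eqP; rewrite addr_eq0 => /eqP ->; rewrite scalerN -scalerBl.
congr (_ *: _); have lt0 : (0 < D)%N by lia. have lt2 : (2 < D)%N by lia.
have cb0 := inter_cb x he hbip hdr lt0; have cb2 := inter_cb x he hbip hdr lt2.
rewrite (inter101 x he hdr lt0) in cb0; apply/eqP.
rewrite subr_eq addrAC eq_sym subr_eq -natrD natr1 eqr_nat /inter_b; apply/eqP; lia.
Qed.

Lemma local_sphere2 : local_mx C e x *m s_ 2 = (p 2 2 2)%:R *: s_ 2.
Proof. by rewrite /local_mx -!mulmxA Estar_sphere Estar_dist_sphere. Qed.

Lemma raise_sphere1 : raise (s_ 1) = (p 2 1 1)%:R *: s_ 2.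
Proof. exact: Estar_dist_sphere. Qed.

Lemma herm_raise u v : E 2 *m u = u -> E 1 *m v = v ->
  herm u (raise v) = herm (E 1 *m (A 1 *m u)) v.
Proof.
move=> uE vE; rewrite herm_mulmx adjmx_Estar vE herm_mulmx (adjmx_dist C he hdr).
by rewrite -[in RHS]uE herm_mulmx adjmx_Estar.
Qed.

Lemma raised_perp_sphere2 : (raised <= perp <[s_ 2]>)%VS.
Proof.
rewrite perp_sym -memvE; apply/perpP => _ /raisedP[v vl ->].
have [vE _ _] := low1P vl; rewrite herm_raise ?Estar_sphere // Estar_dist_sphere hermZl.
by rewrite herm_conj herm_sphere //; have [_ -> _] := low1P vl; rewrite rmorph0 mulr0.
Qed.

Lemma level1_split v : E 1 *m v = v -> exists c, v - c *: s_ 1 \in low1.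
Proof.
move=> vE; have : v \in (<[s_ 1]> + perp <[s_ 1]>)%VS by rewrite add_perp memvf.
case/memv_addP=> _ /vlineP[c ->] [w wp vw]; exists c => //.
rewrite memv_cap mem_level mulmxBr -scalemxAr vE Estar_sphere eqxx.
by rewrite vw addrAC subrr add0r.
Qed.

Lemma mem_kernel_lower u : E 2 *m u = u ->
  (E 1 *m (A 1 *m u) = 0) <-> (u \in perp <[s_ 2]> /\ u \in perp raised).
Proof.
move=> uE; split=> [Lu|[/perpP us /perpP uz]].
  split; apply/perpP => w.
    case/vlineP=> c ->.
    have c2 : (p 2 1 1)%:R != 0 :> C by apply: (inter_c_neq0 C x he hdr); lia.
    rewrite hermZr -[s_ 2]scale1r -(mulVf c2) -scalerA -raise_sphere1 hermZr.
    by rewrite herm_raise ?Estar_sphere // Lu herm0l !mulr0.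
  by case/raisedP=> v /low1P[vE _ _] ->; rewrite herm_raise // Lu herm0l.
apply/eqP; rewrite -herm_eq0; set w := E 1 *m _.
have wE : E 1 *m w = w by exact: EstarK.
have [c wc] := level1_split wE.
have -> : herm w w = herm w (w - c *: s_ 1) + herm w (c *: s_ 1).
  by rewrite -hermDr subrK.
have [vE _ _] := low1P wc.
rewrite -(herm_raise uE vE) uz ?add0r; last by apply/raisedP; exists (w - c *: s_ 1).
rewrite hermZr -(herm_raise uE (Estar_sphere 1)) raise_sphere1 hermZr us ?memv_line //.
by rewrite !mulr0.
Qed.

Lemma raise_inj : (low1 :&: lker (linfun (mulmx (E 2 *m A 1) : V -> V)) = 0)%VS.
Proof.
apply/eqP; rewrite -subv0; apply/subvP => v /memv_capP[vl].
rewrite memv_ker lfunE /= -mulmxA => /eqP v0; rewrite memv0.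
have := lower_raise vl; rewrite /raise v0 !mulmx0 => /esym/eqP.
rewrite scaler_eq0 pnatr_eq0 => /orP[|//] h.
have lt : (2 < D)%N by lia.
by have := inter_b_gt0 x he hdr lt; rewrite lt0n h.
Qed.

Definition vertex_vec (y : X) : V := delta_mx (enum_rank y) 0.

Lemma dim_level i : \dim (level i) = #|[pred y | d x y == i]|.
Proof.
have -> : level i = (\sum_(y <- enum [pred y | d x y == i]) <[vertex_vec y]>)%VS.
  apply/eqP; rewrite eqEsubv; apply/andP; split; last first.
    apply/subv_sumsP => y; rewrite mem_enum inE => /eqP xy; rewrite -memvE mem_level.
    apply/eqP/colP => a; rewrite Estar_mulE mxE andbT.
    by case: (eqVneq a (enum_rank y)) => [->|]; rewrite ?mulr0 // enum_rankK xy eqxx mulr1.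
  apply/subvP => v; rewrite mem_level => /eqP vE.
  rewrite [v]matrix_sum_delta; apply: memv_suml => a _; rewrite big_ord1.
  have [->|va] := eqVneq (v a 0) 0; first by rewrite scale0r mem0v.
  apply: memvZ; have xa : d x (enum_val a) = i.
    by apply/eqP; apply: contraNT va => /negPf xa; rewrite -vE Estar_mulE xa mul0r.
  apply: subvP (sumv_seq_sup (fun y => <[vertex_vec y]>%VS) (i := enum_val a) _) _ _.
    by rewrite mem_enum inE xa.
  by rewrite /vertex_vec enum_valK memv_line.
rewrite dim_orth_sum ?enum_uniq //.
  rewrite [RHS]cardE -[RHS]sum1_size; apply: eq_bigr => y _; rewrite dim_vline.
  by have -> // : vertex_vec y != 0;
    apply/eqP => /colP/(_ (enum_rank y))/eqP; rewrite !mxE !eqxx oner_eq0.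
move=> y z _ _ yz; rewrite -memvE; apply/perpP => _ /vlineP[c ->].
rewrite hermZr /herm big1 ?mulr0 // => a _; rewrite !mxE !andbT.
case: (eqVneq a (enum_rank y)) => [->|]; rewrite ?mul0r // (inj_eq enum_rank_inj) (negPf yz).
by rewrite rmorph0 mulr0.
Qed.

Lemma adjmx_local : adjmx (local_mx C e x) = local_mx C e x.
Proof.
rewrite /local_mx /adjmx !trmx_mul !map_mxM -!/(adjmx _) !adjmx_Estar.
by rewrite (adjmx_dist C he hdr) mulmxA.
Qed.

Lemma local_eigen_orth a b u v : local_mx C e x *m u = a *: u ->
  local_mx C e x *m v = b *: v -> b \is Num.real -> a != b -> herm u v = 0.
Proof.
move=> ua vb br ab; have : herm (local_mx C e x *m u) v = herm u (local_mx C e x *m v).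
  by rewrite herm_mulmx adjmx_local.
rewrite ua vb hermZl hermZr (CrealP br) => /eqP; rewrite -subr_eq0 -mulrBl mulf_eq0.
by rewrite subr_eq0 (negPf ab) => /eqP.
Qed.

(* The eta-eigenspace of the local matrix in E*_2 V_0 + E*_2 Y. *)
Definition low_eigenspace (eta : C) : {vspace V} :=
  ((if eta == (p 2 2 2)%:R then <[s_ 2]> else 0) +
   (if eta == (inter_b p 3)%:R - 1 then raised else 0))%VS.

Lemma low_eigenspace_sub eta :
  (low_eigenspace eta <= local_eigenspace eta :&: level 2)%VS.
Proof.
rewrite subv_add; apply/andP; split.
  case: eqP => [->|_]; last exact: sub0v.
  by rewrite -memvE memv_cap mem_local_eigenspace mem_level local_sphere2 Estar_sphere !eqxx.
case: eqP => [->|_]; last exact: sub0v.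
apply/subvP => _ /raisedP[v vl ->].
by rewrite memv_cap mem_local_eigenspace mem_level local_raise // /raise EstarK !eqxx.
Qed.

Lemma U_spaceE eta :
  U_space eta = (local_eigenspace eta :&: level 2 :&: perp (low_eigenspace eta))%VS.
Proof.
apply/vspaceP => u; rewrite [LHS]memv_cap [RHS]memv_cap.
case: (boolP (u \in _)) => //= /memv_capP[]; rewrite mem_local_eigenspace mem_level.
move=> /eqP ul /eqP uE; rewrite mem_kermx_v -mulmxA.
apply/eqP/perpP => [/(mem_kernel_lower uE)[us uz] _ /memv_addP[a ha [b hb ->]]|h].
  rewrite hermDr; have -> : herm u a = 0.
    move: ha; case: eqP => _; first by move/perpP: us; apply.
    by rewrite memv0 => /eqP->; rewrite herm0r.
  move: hb; case: eqP => _; first by move/perpP: uz => uz /uz ->; rewrite addr0.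
  by rewrite memv0 => /eqP->; rewrite herm0r addr0.
apply/(mem_kernel_lower uE); split; apply/perpP.
  move=> _ /vlineP[c ->]; rewrite hermZr.
  have [eta2|ne] := eqVneq eta (p 2 2 2)%:R.
    by rewrite h ?mulr0 // /low_eigenspace eta2 eqxx; apply: subvP (addvSl _ _) _ (memv_line _).
  by rewrite (local_eigen_orth ul local_sphere2) ?mulr0 ?realn.
move=> z zr; have [etab|ne] := eqVneq eta ((inter_b p 3)%:R - 1).
  by apply: h; rewrite /low_eigenspace etab eqxx; apply: subvP (addvSr _ _) _ zr.
have /raisedP[v vl zE] := zr.
by rewrite (local_eigen_orth ul (_ : _ *m z = ((inter_b p 3)%:R - 1) *: z)) ?zE ?local_raise
  ?rpredB ?realn ?real1.
Qed.

Lemma local_eigenspace_split eta :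
  (local_eigenspace eta :&: level 2 = low_eigenspace eta + U_space eta)%VS.
Proof.
rewrite U_spaceE [(_ :&: perp _)%VS]capvC vspace_modl ?low_eigenspace_sub //.
by rewrite add_perp capfv.
Qed.

Hypothesis k_gt0 : (0 < valency p)%N.

Lemma sphere2_neq0 : s_ 2 != 0.
Proof.
have [y xy] : exists y, d x y = 1%N.
  move: k_gt0; rewrite -(card_neighbours he hdr x) => /card_gt0P[y].
  by rewrite inE => /eqP; exists y.
have [z xz] : exists z, d x z = 2%N.
  have lt : (1 < D)%N by lia.
  have := inter_b_gt0 x he hdr lt; rewrite -xy -(interE hdr) xy => /card_gt0P[z].
  by rewrite inE => /andP[/eqP xz _]; exists z.
apply/eqP => /colP/(_ (enum_rank z))/eqP.
by rewrite Estar_mulE !mxE enum_rankK xz eqxx mulr1 oner_eq0.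
Qed.

Lemma dim_raised : \dim raised = (valency p).-1.
Proof.
rewrite limg_dim_eq ?raise_inj //.
have s1l : (<[s_ 1]> <= level 1)%VS by rewrite -memvE mem_level Estar_sphere.
have : \dim (level 1) = (\dim <[s_ 1]> + \dim low1)%N.
  rewrite -dimv_disjoint_sum; last first.
    by rewrite /low1 capvA (capv_idPl s1l) cap_perp.
  by rewrite /low1 capvC vspace_modl // add_perp capfv.
rewrite dim_level (card_neighbours he hdr) dim_vline => ->.
have -> : s_ 1 != 0; last by rewrite add1n.
apply: contra_neq sphere2_neq0 => s0.
have lt : (1 < D)%N by lia.
have := raise_sphere1; rewrite s0 /raise !mulmx0 => /esym/eqP.
by rewrite scaler_eq0 (negPf (inter_c_neq0 C x he hdr lt)) => /eqP.
Qed.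

Lemma dim_local_eigenspace eta :
  \dim (local_eigenspace eta :&: level 2) =
  ((eta == (p 2 2 2)%:R) + (eta == (inter_b p 3)%:R - 1)%R * (valency p).-1 +
   \dim (U_space eta))%N.
Proof.
rewrite local_eigenspace_split dimv_disjoint_sum; last first.
  apply/eqP; rewrite -subv0 U_spaceE -[X in (_ <= X)%VS](cap_perp (low_eigenspace eta)).
  by rewrite capvS // capvSr.
congr (_ + _)%N; rewrite dimv_disjoint_sum.
  by congr (_ + _)%N; case: eqP; rewrite ?dimv0 // ?dim_vline ?sphere2_neq0 // dim_raised mul1n.
apply/eqP; rewrite -subv0 -[X in (_ <= X)%VS](cap_perp <[s_ 2]>) capvS //.
  by case: eqP; rewrite ?sub0v.
by case: eqP; rewrite ?sub0v ?raised_perp_sphere2.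
Qed.

End LocalEigenspaces.

(** * Multiplicities of the local eigenvalues *)

Lemma char_poly_conj (F : comNzRingType) n (P Q M : 'M[F]_n) :
  Q *m P = 1%:M -> char_poly (Q *m M *m P) = char_poly M.
Proof.
move=> QP; rewrite /char_poly.
have fQP : map_mx polyC Q *m map_mx polyC P = 1%:M by rewrite -map_mxM QP map_mx1.
have -> : char_poly_mx (Q *m M *m P) = map_mx polyC Q *m char_poly_mx M *m map_mx polyC P.
  rewrite /char_poly_mx mulmxBr mulmxBl !map_mxM; congr (_ - _).
  by rewrite scalar_mxC -mulmxA fQP mulmx1.
by rewrite !det_mulmx mulrAC -det_mulmx fQP det1 mul1r.
Qed.

Section Spectral.
Variables (C : numClosedFieldType) (X : finType) (e : rel X) (x : X).
Variable (p : nat -> nat -> nat -> nat).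
Hypotheses (he : simple_graph e) (hbip : bipartite e).
Hypothesis hdr : distance_regular e p.
Hypothesis D_ge4 : (4 <= diameter e)%N.
Hypothesis k_gt0 : (0 < valency p)%N.
Local Notation V := 'cV[C]_#|X|.
Local Notation MX := 'M[C]_#|X|.
Local Notation E := (Estar C e x).
Local Notation A := (dist_mx C e).
Local Notation level := (@level C X e x).
Local Notation local_eigenspace := (@local_eigenspace C X e x).
Local Notation U_space := (@U_space C X e x).
Local Notation S := (sphere2 e x).
Implicit Types (u v w : V) (U W M N : {vspace V}) (B : MX).
Let hcon : graph_connected e := hdr.1.

Definition sphere_inj : 'M[C]_(#|X|, #|S|) :=
  \matrix_(a, b) (enum_val a == enum_val b)%:R.
Local Notation J := sphere_inj.

Lemma sphere_inj_tr : J^t* = J^T.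
Proof. by apply/matrixP => a b; rewrite !mxE conjC_nat. Qed.

Lemma trmx_sphere_inj_mul (B : MX) a b :
  (J^T *m B *m J) a b = B (enum_rank (enum_val a)) (enum_rank (enum_val b)).
Proof.
rewrite mxE (bigD1 (enum_rank (enum_val b))) //= big1 ?addr0 => [|c cb]; last first.
  by rewrite [J _ _]mxE -(inj_eq enum_rank_inj) enum_valK (negPf cb) mulr0.
rewrite [J _ _]mxE enum_rankK eqxx mulr1 mxE (bigD1 (enum_rank (enum_val a))) //=.
rewrite big1 ?addr0 => [|c ca].
  by rewrite !mxE enum_rankK eqxx mul1r.
by rewrite !mxE -(inj_eq enum_rank_inj) enum_valK (negPf ca) mul0r.
Qed.

Lemma sphere_inj_isometry : J^T *m J = 1%:M.
Proof.
rewrite -[J^T]mulmx1; apply/matrixP => a b; rewrite trmx_sphere_inj_mul !mxE.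
by rewrite (inj_eq enum_rank_inj) (inj_eq enum_val_inj).
Qed.

Lemma sphere_inj_proj : J *m J^T = E 2.
Proof.
apply/matrixP => a b; rewrite !mxE; under eq_bigr do rewrite !mxE -natrM mulnb.
have [aS|aS] := boolP (enum_val a \in S); last first.
  rewrite big1 => [|c _].
    by move: aS; rewrite inE => /negPf->; rewrite andbF.
  case: eqP => //= ac; move: aS; rewrite ac.
  by have := enum_valP c; rewrite /= => ->.
rewrite (bigD1 (enum_rank_in aS (enum_val a))) //= enum_rankK_in // eqxx big1 ?addr0.
  by move: aS; rewrite inE => ->; rewrite andbT (inj_eq enum_val_inj) eq_sym.
move=> c cr; case: eqP => //= ac; case/eqP: cr.
by apply: enum_val_inj; rewrite enum_rankK_in.
Qed.

Lemma local_graph_mxE : local_graph_mx C e x = J^T *m A 2 *m J.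
Proof. by apply/matrixP => a b; rewrite trmx_sphere_inj_mul !mxE !enum_rankK. Qed.

Lemma local_spectral : exists (d : 'rV[C]_#|S|) (Q : 'M[C]_(#|X|, #|S|)),
  [/\ Q^t* *m Q = 1%:M, Q *m Q^t* = E 2, local_mx C e x = Q *m diag_mx d *m Q^t* &
      char_poly (local_graph_mx C e x) = \prod_i ('X - (d 0 i)%:P)].
Proof.
set N := local_graph_mx C e x.
have Nt : N^t* = N.
  by apply/matrixP => a b; rewrite !mxE conjC_nat dist_sym.
have /orthomx_spectralP NE : N \is normalmx by apply/normalmxP; rewrite Nt.
set P := spectralmx N in NE; set d := spectral_diag N in NE.
have Pu : P \is unitarymx by exact: spectral_unitarymx.
have PP : P *m P^t* = 1%:M by exact/unitarymxP.
have PP' : P^t* *m P = 1%:M by exact: mulmx1C.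
rewrite invmx_unitary // in NE.
exists d, (J *m P^t*); have QT : (J *m P^t*)^t* = P *m J^T.
  by rewrite trmx_mul map_mxM trmxCK sphere_inj_tr.
rewrite QT; split.
- by rewrite mulmxA -(mulmxA P) sphere_inj_isometry mulmx1.
- by rewrite mulmxA -(mulmxA J) PP' mulmx1 sphere_inj_proj.
- rewrite /local_mx -sphere_inj_proj !mulmxA -(mulmxA J _ (A 2)) -(mulmxA J _ J).
  by rewrite -local_graph_mxE -/N NE !mulmxA.
rewrite {1}NE char_poly_conj // char_poly_trig ?diag_mx_is_trig //.
by apply: eq_bigr => i _; rewrite mxE eqxx mulr1n.
Qed.

Lemma local_eigenbasis : exists (d : 'rV[C]_#|S|) (v : 'I_#|S| -> V),
  [/\ char_poly (local_graph_mx C e x) = \prod_i ('X - (d 0 i)%:P),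
      forall i, d 0 i \is Num.real,
      forall i, v i \in local_eigenspace (d 0 i) /\ v i \in level 2,
      (level 2 <= \sum_i <[v i]>)%VS &
      forall eta, \dim (local_eigenspace eta :&: level 2) =
        count_mem eta [seq d 0 i | i <- enum 'I_#|S|]].
Proof.
have [d [Q [QQ QQ' lQ cN]]] := local_spectral.
pose v i : V := col i Q.
have hv i j : herm (v i) (v j) = (i == j)%:R.
  have := congr1 (fun M : 'M_#|S| => M j i) QQ; rewrite !mxE eq_sym => <-.
  by apply: eq_bigr => a _; rewrite !mxE mulrC.
have vi0 i : v i != 0 by rewrite -herm_eq0 hv eqxx oner_eq0.
have vE i : v i = Q *m delta_mx i 0 by rewrite /v colE.
have lv i : local_mx C e x *m v i = d 0 i *: v i.
  rewrite lQ vE -!mulmxA (mulmxA (Q^t*)) QQ mul1mx scalemxAr; congr (_ *m _).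
  apply/colP => a; rewrite mul_diag_mx !mxE; case: eqP => [->|]; rewrite ?mulr0 //.
have v2 i : v i \in level 2 by rewrite mem_level -QQ' vE -mulmxA (mulmxA (Q^t*)) QQ mul1mx.
have vin i : v i \in local_eigenspace (d 0 i) by rewrite mem_local_eigenspace lv.
have dreal i : d 0 i \is Num.real.
  apply/CrealP; have : herm (local_mx C e x *m v i) (v i) = herm (v i) (local_mx C e x *m v i).
    by rewrite herm_mulmx (adjmx_local C x he hdr).
  by rewrite lv hermZl hermZr hv eqxx !mulr1.
have sumv u : E 2 *m u = u -> u = \sum_i (Q^t* *m u) i 0 *: v i.
  move=> uE; rewrite -{1}uE -QQ' -mulmxA [Q^t* *m u]matrix_sum_delta mulmx_sumr.
  apply: eq_bigr => i _; rewrite big_ord1 -scalemxAr vE; congr (_ *: _).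
  by rewrite -matrix_sum_delta.
exists d, v; split=> //.
  apply/subvP => u; rewrite mem_level => /eqP/sumv ->.
  by apply: memv_sumr => i _; rewrite memvZ ?memv_line.
move=> eta.
have -> : (local_eigenspace eta :&: level 2)%VS =
    (\sum_(i <- [seq i <- enum 'I_#|S| | d 0%R i == eta]) <[v i]>)%VS.
  apply/eqP; rewrite eqEsubv; apply/andP; split; last first.
    apply/subv_sumsP => i; rewrite mem_filter => /andP[/eqP <- _].
    by rewrite -memvE memv_cap vin v2.
  apply/subvP => u /memv_capP[]; rewrite mem_local_eigenspace mem_level.
  move=> /eqP lu /eqP uE; rewrite (sumv u uE); apply: memv_suml => i _.
  have [di|ne] := eqVneq (d 0 i) eta.
    apply: memvZ; apply: subvP (sumv_seq_sup (fun i => <[v i]>%VS) _) _ (memv_line _).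
    by rewrite mem_filter di eqxx mem_enum.
  suff -> : (Q^t* *m u) i 0 = 0 by rewrite scale0r mem0v.
  have := congr1 (fun u => (Q^t* *m u) i 0) lu.
  rewrite lQ !mulmxA QQ mul1mx -mulmxA mul_diag_mx -scalemxAr !mxE => /eqP.
  by rewrite -subr_eq0 -mulrBl mulf_eq0 subr_eq0 (negPf ne) => /eqP.
have ue : uniq [seq i <- enum 'I_#|S| | d 0 i == eta] by exact/filter_uniq/enum_uniq.
rewrite (dim_orth_sum ue).
  rewrite count_map -size_filter -sum1_size; apply: eq_bigr => i _.
  by rewrite dim_vline vi0.
move=> i j _ _ ij; rewrite -memvE; apply/perpP => _ /vlineP[c ->].
by rewrite hermZr hv (negPf ij) mulr0.
Qed.

Lemma mult_etaE eta : mult_eta e x p eta = \dim (U_space eta).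
Proof.
have [d [v [cN _ _ _ dimE]]] := local_eigenbasis.
set s0 := [seq d 0 i | i <- enum 'I_#|S|] in dimE.
have cN0 : char_poly (local_graph_mx C e x) = \prod_(a <- s0) ('X - a%:P).
  by rewrite cN big_map big_enum.
pose t : seq C := (p 2 2 2)%:R :: nseq (valency p).-1 ((inter_b p 3)%:R - 1).
have szt : size t = valency p by rewrite /= size_nseq prednK.
have count0 a : count_mem a s0 = (count_mem a t + \dim (U_space a))%N.
  rewrite -dimE (dim_local_eigenspace x he hbip hdr D_ge4 k_gt0) /= count_nseq /=.
  by rewrite ![_ == a]eq_sym.
have [rest s0E] : exists rest, perm_eq s0 (t ++ rest).
  have /count_subseqP[t' t's0 tt'] : forall a, (count_mem a t <= count_mem a s0)%N.
    by move=> a; rewrite count0 leq_addr.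
  have [rest s0r] := perm_to_subseq t's0; exists rest.
  by rewrite (perm_trans s0r) // perm_cat2r perm_sym.
apply: xget_unique.
  exists (t ++ rest); split.
    split=> [||i /andP[i0 ik]].
    - by rewrite cN0; apply: perm_big.
    - by [].
    - by rewrite nth_cat szt ik; case: i i0 ik => // i _ ik; rewrite /= nth_nseq ifT //; lia.
  rewrite -szt drop_size_cat //; apply/eqP.
  rewrite -(eqn_add2l (count_mem eta t)) -count_cat -count0.
  by apply/eqP; have /permP := s0E; apply.
move=> m [s [[cs s_0 s_i] ->]].
have ps : perm_eq s0 s by apply: prod_XsubC_eq; rewrite -cs -cN0.
have sz : (valency p <= size s)%N.
  by rewrite -(perm_size ps) (perm_size s0E) size_cat szt leq_addr.
have tE : take (valency p) s = t.
  apply: (@eq_from_nth _ 0) => [|i]; first by rewrite size_takel // szt.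
  rewrite size_takel // => ik; rewrite nth_take //.
  case: i ik => [_|i ik]; first by rewrite s_0.
  by rewrite s_i //= nth_nseq ifT //; lia.
apply/eqP; rewrite -(eqn_add2l (count_mem eta t)) -count0 -{1}tE -count_cat cat_take_drop.
by apply/eqP/esym; have /permP := ps; apply.
Qed.

End Spectral.

(** * The equivalences *)

Section Equivalences.
Variables (C : numClosedFieldType) (X : finType) (e : rel X) (x : X).
Variable (p : nat -> nat -> nat -> nat).
Hypotheses (he : simple_graph e) (hbip : bipartite e).
Hypothesis hdr : distance_regular e p.
Hypothesis D_ge4 : (4 <= diameter e)%N.
Hypothesis k_gt0 : (0 < valency p)%N.
Local Notation V := 'cV[C]_#|X|.
Local Notation E := (Estar C e x).
Local Notation A := (dist_mx C e).
Local Notation U_space := (@U_space C X e x).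
Implicit Types (u v w : V) (W : {vspace V}).

Lemma U_eta_eqP eta :
  U_eta e x eta = [set E 2 *m v | v in H_eta e x eta] <->
  mult_eta e x p eta = mu_eta e x eta.
Proof.
have [s hs] := exists_T_decomposition C x he hdr.
rewrite (mult_etaE x he hbip hdr D_ge4 k_gt0) (mu_etaE he hbip hdr D_ge4 eta hs).
have HU : (thin2_space e x eta s <= U_space eta)%VS.
  apply/subvP => v /(mem_thin2_space he hbip hdr eta v hs)[h hh <-].
  exact: Estar_H_eta_sub.
split=> [eqUH|eqd].
  congr (\dim _); apply/eqP; rewrite eqEsubv HU andbT; apply/subvP => u.
  move/(mem_U_space x he hbip hdr D_ge4 eta u); rewrite eqUH => -[h hh hu].
  by apply/(mem_thin2_space he hbip hdr eta u hs); exists h.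
have UH : thin2_space e x eta s = U_space eta.
  by apply/eqP; rewrite eqEdim HU eqd leqnn.
apply/seteqP; split=> u.
  move/(mem_U_space x he hbip hdr D_ge4 eta u); rewrite -UH.
  by move/(mem_thin2_space he hbip hdr eta u hs)=> [h hh hu]; exists h.
move=> [h hh hu]; apply/(mem_U_space x he hbip hdr D_ge4 eta u); rewrite -hu.
exact: Estar_H_eta_sub.
Qed.

Lemma herm_sum_orth (s : seq {vspace V}) (f : {vspace V} -> V) W :
  orth_decomposition e x s -> (forall W, W \in s -> f W \in W) -> W \in s ->
  herm (\sum_(W <- s) f W) (f W) = herm (f W) (f W).
Proof.
case=> _ us orth _ fs Ws; rewrite herm_suml (bigD1_seq W) //= big1_seq ?addr0 //.
by move=> W' /andP[ne W's]; apply: (orth W' W) => //; exact: fs.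
Qed.

Lemma thin_U_eta : (forall W, T_irreducible e x W -> endpoint e x W = 2%N -> thin e x W) ->
  forall eta, U_eta e x eta = [set E 2 *m v | v in H_eta e x eta].
Proof.
move=> hthin eta; apply/seteqP; split=> [u|_ [h hh <-]]; last first.
  by apply/(mem_U_space x he hbip hdr D_ge4 eta _); exact: Estar_H_eta_sub.
have [s hs] := exists_T_decomposition C x he hdr; have [irr us _ sums] := hs.
move=> [/(UP x he hbip hdr D_ge4)[uE Lu] lu].
suff : u \in thin2_space e x eta s.
  by case/(mem_thin2_space he hbip hdr eta u hs)=> h hh hu; exists h.
have : u \in (\sum_(W <- s) W)%VS by rewrite sums memvf.
case/(mem_sumsP (F := id))=> f fs /(_ us) uf.
pose g W := E 2 *m f W.
have gs W : W \in s -> g W \in W.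
  move=> Ws; have [TW _ _] := irr _ Ws; apply: TW (fs _ Ws).
  exact: terw_EstarT.
have ug : u = \sum_(W <- s) g W by rewrite -mulmx_sumr -uf uE.
pose z W := local_mx C e x *m g W - eta *: g W.
have zs W : W \in s -> z W \in W.
  move=> Ws; have [TW _ _] := irr _ Ws; rewrite memvB ?memvZ ?gs //.
  by apply: TW (gs _ Ws); exact: terw_local he hbip hdr.
have z0 W : W \in s -> z W = 0.
  move=> Ws; apply/eqP; rewrite -herm_eq0 -(herm_sum_orth hs zs Ws).
  by rewrite sumrB -mulmx_sumr -scaler_sumr -ug lu subrr herm0l.
rewrite ug big_seq; apply: memv_suml => W Ws.
have [->|g0] := eqVneq (g W) 0; first exact: mem0v.
have gE : g W \in Estar_img e x 2 W by exact: mem_Estar_img (fs _ Ws).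
suff hW : thin2 e x eta W.
  apply: subvP gE; apply: (sumv_seq_sup (Estar_img e x 2)).
  by rewrite mem_filter Ws andbT; apply/asboolP.
have [_ _ low] := endpointP (irr _ Ws).
suff e2 : endpoint e x W = 2%N.
  split=> //; [exact: irr | by apply: hthin => //; exact: irr |].
  by exists (g W); split=> //; apply/eqP; rewrite -subr_eq0 -/(z W) z0.
have [lt|ge] := ltnP (endpoint e x W) 2.
  case/eqP: g0; apply/eqP; rewrite -herm_eq0 -(herm_sum_orth hs gs Ws) -ug.
  by rewrite (herm_low_endpoint he hbip hdr D_ge4 uE Lu (irr _ Ws)) ?fs.
apply/eqP; rewrite eqn_leq ge andbT leqNgt; apply: contra g0 => lt.
by apply/eqP; exact: low (fs _ Ws).
Qed.

Lemma U_eta_thin : (forall eta, eta \is Num.real ->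
    U_eta e x eta = [set E 2 *m v | v in H_eta e x eta]) ->
  forall W, T_irreducible e x W -> endpoint e x W = 2%N -> thin e x W.
Proof.
move=> hU W hW eW; apply/not_notP => nthin.
have [w [wW]] := T_irreducible_vector hW; rewrite eW => wE.
have [TW _ _] := hW; have [_ _ low] := endpointP hW; rewrite eW in low.
have Lw : E 1 *m (A 1 *m w) = 0 by apply: low => //; apply: TW => //; exact: terw_A.
have [ws wz] := (mem_kernel_lower he hdr D_ge4 wE).1 Lw.
have [d [v [_ dreal vin sp _]]] := local_eigenbasis C x he hdr.
have Uw eta : eta \is Num.real -> (U_space eta <= perp <[w]>)%VS.
  move=> er; apply/subvP => u /(mem_U_space x he hbip hdr D_ge4 eta u).
  rewrite hU // => -[h hh <-]; apply/perpP => _ /vlineP[c ->].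
  rewrite hermZr herm_mulmx adjmx_Estar wE.
  elim/span_of_ind: _ / hh => [|u1 u2 h1 h2|W' u1 hW' u1W']; first by rewrite herm0l mulr0.
    by rewrite hermDl mulrDr h1 h2 addr0.
  have [irrW' tW' _ _] := hW'.
  case: (schur he hdr irrW' hW) => [/subvP/(_ _ u1W')/perpP->//|iso]; first by rewrite mulr0.
  by case: nthin; apply: (T_iso_thin _ iso tW'); case: irrW'.
have low_w eta : (low_eigenspace e x p eta <= perp <[w]>)%VS.
  rewrite perp_sym -memvE; apply/perpP => _ /memv_addP[a ha [b hb ->]]; rewrite hermDr.
  have -> : herm w a = 0.
    move: ha; case: eqP => _; first by move/perpP: ws; apply.
    by rewrite memv0 => /eqP->; rewrite herm0r.
  move: hb; case: eqP => _; first by move/perpP: wz => wz' /wz' ->; rewrite addr0.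
  by rewrite memv0 => /eqP->; rewrite herm0r addr0.
have : (level C e x 2 <= perp <[w]>)%VS.
  apply: subv_trans sp _; apply/subv_sumP => i _; rewrite -memvE.
  have [vl v2] := vin i.
  have : v i \in (local_eigenspace e x (d 0%R i) :&: level C e x 2)%VS by rewrite memv_cap vl.
  rewrite (local_eigenspace_split x he hbip hdr D_ge4) => h.
  by apply: subvP h; rewrite subv_add low_w Uw.
move/subvP/(_ w); rewrite mem_level wE eqxx => /(_ isT)/perpP/(_ _ (memv_line w))/eqP.
by rewrite herm_eq0 => -> .
Qed.

End Equivalences.

Local Open Scope complex_scope.

Theorem theorem17p8 (R : realType) (X : finType) (e : rel X)
    (p : nat -> nat -> nat -> nat) (x : X)
    (he : simple_graph e) (hbip : bipartite e) (hdr : distance_regular e p)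
    (hD : (4 <= diameter e)%N) (hk : (3 <= valency p)%N) :
  let i_ := forall eta : R,
    U_eta e x eta%:C =
      [set (Estar R[i] e x 2 *m v)%R | v in H_eta e x eta%:C] in
  let ii_ := forall eta : R, mult_eta e x p eta%:C = mu_eta e x eta%:C in
  let iii_ := forall W : {vspace 'cV[R[i]]_#|X|},
    T_irreducible e x W -> endpoint e x W = 2%N -> thin e x W in
  (i_ <-> ii_) /\ (ii_ <-> iii_).
Proof.
move=> i_ ii_ iii_; have k0 : (0 < valency p)%N by exact: leq_trans hk.
have i_ii : i_ <-> ii_.
  by split=> h eta; apply/(U_eta_eqP x he hbip hdr hD k0); exact: h.
split=> //; split=> [/i_ii hi|hiii].
  apply: (U_eta_thin he hbip hdr hD) => eta /RRe_real <-; exact: hi.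
by apply/i_ii => eta; exact: (thin_U_eta he hbip hdr hD hiii).
Qed.
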